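(* Let $(\mathcal{A},\gamma)$ be a full $C^*$-dynamical system over $\mathbb{T}$ with $\mathcal{A}$ unital. Then there exists a full finite projective Hilbert $C^*$-bimodule $X$ over a unital $C^*$-algebra $\mathcal{B}$ such that $(\mathcal{A},\gamma)$ can be identified with the Pimsner algebra $\mathcal{O}_X$ endowed with its canonical gauge action; that is, there is a $*$-isomorphism $\mathcal{O}_X\to\mathcal{A}$ intertwining the canonical gauge action of $\mathbb{T}$ on $\mathcal{O}_X$ with $\gamma$.
   Context: $\gamma$ is a (strongly continuous) action of $\mathbb{T}$ on $\mathcal{A}$ by $*$-automorphisms; $\mathcal{A}^k=\{a\in\mathcal{A}:\gamma_z(a)=z^ka\ \forall z\in\mathbb{T}\}$. The system is full if for every $k\in\mathbb{Z}$ the closed linear span of $\{xy:x\in\mathcal{A}^k,y\in\mathcal{A}^{-k}\}$ equals $\mathcal{A}^0$. A Hilbert $C^*$-bimodule over a unital $C^*$-algebra $\mathcal{B}$ is a right Hilbert $\mathcal{B}$-module $X$ with a faithful unital $*$-homomorphism $\phi:\mathcal{B}\to\mathcal{L}_{\mathcal{B}}(X)$ (left action). It is full if the inner products $\langle x,y\rangle$ span a dense subspace of $\mathcal{B}$, and finite projective if it has a finite basis, i.e. a finite subset $\{x_j\}$ with $x=\sum_jx_j\langle x_j,x\rangle$ for all $x\in X$. The Pimsner algebra $\mathcal{O}_X$ is the universal unital $C^*$-algebra generated by copies of $\mathcal{B}$ and $X$ such that the bimodule operations and the inner product are realized in it by multiplication ($x\cdot b=xb$, $\phi(b)x=bx$,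 $x^*y=\langle x,y\rangle$) and $\sum_jx_jx_j^*=I$ for a finite basis $\{x_j\}$ of $X$. Its canonical gauge action is the $\mathbb{T}$-action fixing $\mathcal{B}$ pointwise and sending $x\in X$ to $zx$, $z\in\mathbb{T}$. *)

(* Defs.v *)
From HB Require Import structures.
From mathcomp Require Import all_boot all_order all_algebra finmap.
From mathcomp Require Import all_classical all_reals all_analysis.

Set Implicit Arguments.
Unset Strict Implicit.
Unset Printing Implicit Defensive.

Import Order.TTheory GRing.Theory Num.Theory.
Import numFieldNormedType.Exports.
Local Open Scope classical_set_scope.
Local Open Scope ring_scope.

(* Everything is parametrized by a field K of scalars; the complex numbers are
   K = R[i] with R : realType. Norms of normed K-modules take their values in
   the nonnegative elements of K. *)

(* The norm of a normed module and the product of a ring cannot be combined on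
   one type (Num.NumDomain already inherits from both), so the product and the
   unit are fields of the record. The zero algebra, in which 1 = 0, is allowed. *)
Record cstarAlgType (K : numClosedFieldType) := {
  cstar_car :> completeNormedModType K ;
  cmul : cstar_car -> cstar_car -> cstar_car ;
  cone : cstar_car ;
  star : cstar_car -> cstar_car ;
  cmulA : forall a b c, cmul a (cmul b c) = cmul (cmul a b) c ;
  cmul1l : forall a, cmul cone a = a ;
  cmul1r : forall a, cmul a cone = a ;
  cmulDl : forall a b c, cmul (a + b) c = cmul a c + cmul b c ;
  cmulDr : forall a b c, cmul a (b + c) = cmul a b + cmul a c ;
  cmulZl : forall (k : K) a b, cmul (k *: a) b = k *: cmul a b ;
  cmulZr : forall (k : K) a b, cmul a (k *: b) = k *: cmul a b ;
  starK : forall a, star (star a) = a ;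
  starD : forall a b, star (a + b) = star a + star b ;
  starZ : forall (k : K) a, star (k *: a) = Num.conj k *: star a ;
  starM : forall a b, star (cmul a b) = cmul (star b) (star a) ;
  cnormM : forall a b, `|cmul a b| <= `|a| * `|b| ;
  cnorm_star : forall a, `|cmul (star a) a| = `|a| ^+ 2
}.
Arguments cone {K A} : rename.

Local Infix "**" := cmul (at level 40, left associativity).

Section Generalities.
Variable K : numClosedFieldType.

Definition lin_span (V : lmodType K) (S : set V) : set V :=
  [set x | exists (n : nat) (c : 'I_n -> K) (v : 'I_n -> V),
     (forall i, S (v i)) /\ x = \sum_i c i *: v i].

Definition closed_span (V : normedModType K) (S : set V) : set V :=
  closure (lin_span S).

Definition is_linear (V W : lmodType K) (f : V -> W) : Prop :=
  forall (k : K) (x y : V), f (k *: x + y) = k *: f x + f y.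

(* Unital *-homomorphisms. *)
Definition star_hom (A B : cstarAlgType K) (f : A -> B) : Prop :=
  [/\ is_linear f,
      f cone = cone,
      forall a b, f (a ** b) = f a ** f b
    & forall a, f (star a) = star (f a)].

Definition star_iso (A B : cstarAlgType K) (f : A -> B) : Prop :=
  star_hom f /\ bijective f.

Definition cstar_pos (A : cstarAlgType K) (a : A) : Prop :=
  exists b : A, a = star b ** b.

Definition cstar_subalgebra (A : cstarAlgType K) (S : set A) : Prop :=
  [/\ closed S, S cone,
      forall (k : K) a b, S a -> S b -> S (k *: a + b),
      forall a b, S a -> S b -> S (a ** b)
    & forall a, S a -> S (star a)].

Definition cstar_generated (A : cstarAlgType K) (G : set A) : Prop :=
  forall S : set A, cstar_subalgebra S -> G `<=` S -> S = setT.

End Generalities.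

Section CircleActions.
Variable K : numClosedFieldType.

Definition circle : set K := [set z | `|z| = 1].

(* An action of the circle group is a map defined on all of K of which only
   the values at the points of the circle matter. *)
Definition circle_action (A : cstarAlgType K) (gamma : K -> A -> A) : Prop :=
  [/\ forall z, circle z -> star_iso (gamma z),
      forall a, gamma 1 a = a,
      forall z w, circle z -> circle w ->
        forall a, gamma (z * w) a = gamma z (gamma w a)
    & forall a, {within circle, continuous (fun z => gamma z a)}].

Definition spectral_subspace (A : cstarAlgType K) (gamma : K -> A -> A)
    (k : int) : set A :=
  [set a | forall z, circle z -> gamma z a = (z ^ k) *: a].

Definition full_action (A : cstarAlgType K) (gamma : K -> A -> A) : Prop :=
  forall k : int,
    closed_span [set a | exists x y, [/\ spectral_subspace gamma k x,
                           spectral_subspace gamma (- k) y & a = x ** y]]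
    = spectral_subspace gamma 0.

End CircleActions.

(* The inner product is linear in its second argument. Completeness is that of
   the underlying normed space, whose norm is the one given by the inner
   product. *)
Record hilbertModule (K : numClosedFieldType) (B : cstarAlgType K) := {
  hm_car :> completeNormedModType K ;
  ract : hm_car -> B -> hm_car ;
  inner : hm_car -> hm_car -> B ;
  ract_linearl : forall b, is_linear (fun x => ract x b) ;
  ract_linearr : forall x, is_linear (ract x) ;
  ractM : forall x b c, ract x (b ** c) = ract (ract x b) c ;
  ract1 : forall x, ract x cone = x ;
  inner_linear : forall x, is_linear (inner x) ;
  inner_ract : forall x y b, inner x (ract y b) = inner x y ** b ;
  inner_star : forall x y, star (inner x y) = inner y x ;
  inner_pos : forall x, cstar_pos (inner x x) ;
  inner_def : forall x, inner x x = 0 -> x = 0 ;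
  inner_norm : forall x, `|x| ^+ 2 = `|inner x x|
}.

Definition is_adjoint (K : numClosedFieldType) (B : cstarAlgType K)
    (X : hilbertModule B) (T S : X -> X) : Prop :=
  forall x y, inner (T x) y = inner x (S y).

(* [lact] is the left action phi. By [lact_star] every [lact b] is adjointable,
   hence linear and bounded, and phi preserves the involutions. *)
Record hilbertBimodule (K : numClosedFieldType) (B : cstarAlgType K) := {
  hb_module :> hilbertModule B ;
  lact : B -> hb_module -> hb_module ;
  lact_star : forall b, is_adjoint (lact b) (lact (star b)) ;
  lact_linear : forall x, is_linear (fun b => lact b x) ;
  lactM : forall b c x, lact (b ** c) x = lact b (lact c x) ;
  lact1 : forall x, lact cone x = x ;
  lact_faithful : injective lact
}.

Section Bimodules.
Variables (K : numClosedFieldType) (B : cstarAlgType K).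

Definition full_module (X : hilbertModule B) : Prop :=
  dense (lin_span [set b | exists x y : X, b = inner x y]).

Definition is_basis (X : hilbertModule B) (s : {fset X}) : Prop :=
  forall x : X, x = \sum_(e <- s) ract e (inner e x).

Definition finite_projective (X : hilbertModule B) : Prop :=
  exists s : {fset X}, is_basis s.

Definition pimsner_relations (X : hilbertBimodule B) (D : cstarAlgType K)
    (iB : B -> D) (iX : X -> D) : Prop :=
  star_hom iB /\ is_linear iX /\
  [/\ forall x b, iX (ract x b) = iX x ** iB b,
      forall b x, iX (lact b x) = iB b ** iX x,
      forall x y, star (iX x) ** iX y = iB (inner x y)
    & exists2 s : {fset X}, is_basis s &
        \sum_(e <- s) iX e ** star (iX e) = cone].

(* The algebras D of the universal property are arbitrary: jB and jX are not
   assumed injective. O, with the copies iB of B and iX of X in it, is the Pimsner algebra of X. *)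
Definition is_pimsner_algebra (X : hilbertBimodule B) (O : cstarAlgType K)
    (iB : B -> O) (iX : X -> O) : Prop :=
  [/\ injective iB /\ injective iX,
      pimsner_relations iB iX,
      cstar_generated (range iB `|` range iX)
    & forall (D : cstarAlgType K) (jB : B -> D) (jX : X -> D),
        pimsner_relations jB jX ->
        exists f : O -> D, [/\ star_hom f,
          forall b, f (iB b) = jB b & forall x, f (iX x) = jX x]].

Definition is_gauge_action (X : hilbertBimodule B) (O : cstarAlgType K)
    (iB : B -> O) (iX : X -> O) (alpha : K -> O -> O) : Prop :=
  [/\ circle_action alpha,
      forall z, circle z -> forall b, alpha z (iB b) = iB b
    & forall z, circle z -> forall x, alpha z (iX x) = z *: iX x].

End Bimodules.

(* Main.v *)
(* With [B = A^0] and [X = A^1] the Pimsner algebra is [A] itself.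

   A frame: by fullness [1] is close to some [sum x_j y_j] with [x_j] in [A^1] and
   [y_j] in [A^-1], so [s = sum (x_j x_j^* + y_j^* y_j)] is positive and
   invertible, and the [s^(-1/2) x_j], [s^(-1/2) y_j^*] form a basis of [X].

   Generation: a basis reduces [A^k] to [A^0] and [A^1], and the Fejer means of an
   element, with the spectral projections obtained as limits of averages over the
   roots of unity of order [2^n], are sums of homogeneous elements near it.

   Universality: a representation of [(B, X)] extends to the homogeneous elements
   and is contractive on each [A^k], hence bounded by [(2 L + 1) |p|] on sums [p]
   with degrees in [-L, L]. Applied to the powers of [p^* p] this gives
   contractivity, and the representation extends to [A] by density.

   Positivity needs no spectral theory: if [g], [d] are commuting and
   self-adjoint with [g^2 + d^2 = 1], then [g + i d] is unitary, so [|g| <= 1]. *)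

Require Import Defs.
From HB Require Import structures.
From mathcomp Require Import all_boot all_order all_algebra finmap complex.
From mathcomp Require Import ring lra zify.
From mathcomp Require Import all_classical all_reals all_analysis.
Set Implicit Arguments.
Unset Strict Implicit.
Unset Printing Implicit Defensive.
Import Order.TTheory GRing.Theory Num.Theory.
Import numFieldNormedType.Exports.
Local Open Scope complex_scope.
Local Open Scope ring_scope.
Local Infix "**" := cmul (at level 40, left associativity).

(** * Real-valued norms and convergence of sequences *)

(** The homomorphism of the universal property has no direct formula: an element of [A^k] is in many
    ways a sum of words in [A^1], its adjoints and [A^0]. It is therefore built as a relation
    generated by such words, and single-valuedness comes last, from a norm bound. The bound starts
    in degree 0, where a word is brought back into [B] through [star x ** y = <x, y>] and through
    [x ** star y], which the frame identity in [D] ties to [B]. A pair [(a, d)] of degree [k] yields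
    [(star a ** a, star d ** d)] of degree 0, and *-homomorphisms contract. The factor [2 L + 1]
    counts degrees: each component of [p] is an average over roots of unity, hence no larger than
    [p]. Orders [2^n] make the groups of roots nested, so that a coarse average fixes a finer one;
    this gives the Cauchy property. The other obstacle is positivity of [star x ** x], needed for
    the frame and for the inner product of [X]. It follows Kaplansky's argument, for which the
    unitary trick is sharpened to [|g| < 1] when [d] is invertible; this takes the place of the
    spectral radius. *)

Section RealNorm.
Variable R : realType.
Notation K := R[i].

(** Norms take values in [R[i]], whose order is partial; passing to [R] gives a total order and
    makes [lra] and [nra] applicable. *)
Definition rn (V : normedZmodType K) (x : V) : R := complex.Re `|x|.

Section Zmod.
Variable V : normedZmodType K.
Implicit Types x y : V.

Lemma rnE x : `|x| = (rn x)%:C.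
Proof. by rewrite /rn RRe_real // ger0_real. Qed.

Lemma rn_ge0 x : 0 <= rn x.
Proof. by rewrite -ler0c -rnE. Qed.

Lemma rn_eq0 x : (rn x = 0) <-> x = 0.
Proof.
split=> [x0|->]; last by rewrite /rn normr0.
by apply/eqP; rewrite -normr_eq0 rnE x0.
Qed.

Lemma rn0 : rn (0 : V) = 0. Proof. exact/rn_eq0. Qed.

Lemma rnN x : rn (- x) = rn x. Proof. by rewrite /rn normrN. Qed.

Lemma rnB x y : rn (x - y) = rn (y - x). Proof. by rewrite /rn distrC. Qed.

Lemma rnD x y : rn (x + y) <= rn x + rn y.
Proof. by rewrite -lecR rmorphD /= -!rnE ler_normD. Qed.

Lemma rn_tri y x z : rn (x - z) <= rn (x - y) + rn (y - z).
Proof. by apply: le_trans (rnD _ _); rewrite addrA subrK. Qed.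

Lemma rn_sum (I : Type) (r : seq I) (P : pred I) (F : I -> V) :
  rn (\sum_(i <- r | P i) F i) <= \sum_(i <- r | P i) rn (F i).
Proof.
elim/big_rec2: _ => [|i s u _ le]; first by rewrite rn0.
by apply: le_trans (rnD _ _) _; rewrite lerD2l.
Qed.

Lemma rn_small x : (forall e : R, 0 < e -> rn x <= e) -> x = 0.
Proof.
move=> le; apply/rn_eq0/eqP; rewrite eq_le rn_ge0 andbT.
by apply/ler_addgt0Pl => e /le; rewrite addr0.
Qed.

End Zmod.

Lemma rnZ (V : normedModType K) (k : K) (x : V) : rn (k *: x) = rn k * rn x.
Proof. by apply: complexI; rewrite rmorphM /= -!rnE normrZ. Qed.

Lemma rnM (k l : K) : rn (k * l) = rn k * rn l.
Proof. by apply: complexI; rewrite rmorphM /= -!rnE normrM. Qed.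

Lemma rnR (t : R) : rn (t%:C : K) = `|t|.
Proof. by rewrite /rn normc_def /= expr0n addr0 sqrtr_sqr. Qed.

Lemma rn1 : rn (1 : K) = 1.
Proof. by rewrite (rnR 1) normr1. Qed.

Lemma rnRZ (V : normedModType K) (t : R) (x : V) :
  0 <= t -> rn (t%:C *: x) = t * rn x.
Proof. by move=> t0; rewrite rnZ rnR ger0_norm. Qed.

Definition conv (V : normedModType K) (u : nat -> V) (l : V) :=
  forall e : R, 0 < e -> exists n, forall m, (n <= m)%N -> rn (u m - l) <= e.

(** One centre [u n] per tail, as in the ball form of Cauchy filters; monotone majorants and nested
    averages give exactly this form. *)
Definition rcauchy (V : normedModType K) (u : nat -> V) :=
  forall e : R, 0 < e -> exists n, forall m, (n <= m)%N -> rn (u m - u n) <= e.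

Section Conv.
Variable V : normedModType K.
Implicit Types (u v : nat -> V) (l : V).

Lemma conv_cvg u l : conv u l <-> (u @ \oo --> l)%classic.
Proof.
split=> [cu|/cvgrPdist_le cu e e0].
  apply/cvgrPdist_le => e e0.
  have e0' : 0 < complex.Re e by move: e0; rewrite ltcE => /andP[].
  have [n nP] := cu _ e0'; exists n => // m /= nm.
  rewrite rnE rnB; have -> : e = (complex.Re e)%:C by rewrite RRe_real // gtr0_real.
  by rewrite lecR nP.
have [|n _ nP] := cu e%:C; first by rewrite ltcR.
by exists n => m nm; rewrite rnB -lecR -rnE nP.
Qed.

Lemma conv_uniq u l l' : conv u l -> conv u l' -> l = l'.
Proof.
move=> cu cu'; apply/subr0_eq/rn_small => e e0.
have e20 : 0 < e / 2 by rewrite divr_gt0.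
have [n nP] := cu _ e20; have [n' nP'] := cu' _ e20.
have := nP _ (leq_maxl n n'); have := nP' _ (leq_maxr n n').
by have := rn_tri (u (maxn n n')) l l'; rewrite (rnB l (u _)); lra.
Qed.

Lemma conv_cst l : conv (fun=> l) l.
Proof. by move=> e e0; exists 0%N => m _; rewrite subrr rn0 ltW. Qed.

Lemma conv_lip (W : normedModType K) (f : V -> W) (c : R) u l :
  (forall x y, rn (f x - f y) <= c * rn (x - y)) ->
  conv u l -> conv (fun n => f (u n)) (f l).
Proof.
move=> lf cu e e0.
have c1 : 0 < `|c| + 1 by rewrite ltr_pwDr.
have [|n nP] := cu (e / (`|c| + 1)); first by rewrite divr_gt0.
exists n => m /nP; rewrite ler_pdivlMr // => le; apply: le_trans (lf _ _) _.
apply: le_trans le; rewrite mulrC ler_wpM2l ?rn_ge0 //.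
by have := ler_norm c; lra.
Qed.

Lemma convD u v l l' : conv u l -> conv v l' -> conv (fun n => u n + v n) (l + l').
Proof.
move=> cu cv e e0; have e20 : 0 < e / 2 by rewrite divr_gt0.
have [n nP] := cu _ e20; have [n' nP'] := cv _ e20.
exists (maxn n n') => m; rewrite geq_max => /andP[/nP h /nP' h'].
by rewrite opprD addrACA; apply: le_trans (rnD _ _) _; lra.
Qed.

Lemma convZ (k : K) u l : conv u l -> conv (fun n => k *: u n) (k *: l).
Proof. by apply: (conv_lip (c := rn k)) => x y; rewrite -scalerBr rnZ. Qed.

Lemma conv_sum (I : Type) (r : seq I) (P : pred I) (u : I -> nat -> V) (l : I -> V) :
  (forall i, P i -> conv (u i) (l i)) ->
  conv (fun n => \sum_(i <- r | P i) u i n) (\sum_(i <- r | P i) l i).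
Proof.
move=> cu; elim: r => [|i r IH].
  by rewrite big_nil; under eq_fun do rewrite big_nil; exact: conv_cst.
rewrite big_cons; under eq_fun do rewrite big_cons.
by case: ifP => // Pi; apply: convD => //; exact: cu.
Qed.

Lemma conv_rn_le u l (c : R) : conv u l -> (forall n, rn (u n) <= c) -> rn l <= c.
Proof.
move=> cu le; apply/ler_addgt0Pl => e e0; have [n nP] := cu _ e0.
have := nP n (leqnn n); have := le n.
by have := rnD (u n) (l - u n); rewrite addrC subrK (rnB l); lra.
Qed.

Lemma conv_bounded u l : conv u l -> exists c, forall n, rn (u n) <= c.
Proof.
move=> cu; have [n nP] := cu 1 ltr01.
have [b bP] : exists b, forall m, (m < n)%N -> rn (u m) <= b.
  elim: n {nP} => [|n [b bP]]; first by exists 0.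
  exists (Num.max b (rn (u n))) => m; rewrite ltnS leq_eqVlt => /orP[/eqP->|/bP h].
    by rewrite le_max lexx orbT.
  by rewrite le_max h.
exists (Num.max b (1 + rn l)) => m; rewrite le_max.
case: (leqP n m) => [/nP h|/bP -> //]; apply/orP; right.
by have := rnD (u m - l) l; rewrite subrK; lra.
Qed.

Lemma closedP (S : set V) :
  closed S <-> (forall x, (forall e : R, 0 < e -> exists2 y, S y & rn (x - y) < e) -> S x).
Proof.
split=> [cS x xP|SP].
  rewrite (closure_id S).1 // => B /nbhs_ballP[e /= e0 eB].
  have e0' : 0 < complex.Re e by move: e0; rewrite ltcE => /andP[].
  have [y Sy yP] := xP _ e0'; exists y; split=> //; apply: eB.
  rewrite -ball_normE /= rnE; have -> : e = (complex.Re e)%:C by rewrite RRe_real // gtr0_real.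
  by rewrite ltcR.
rewrite closure_id eqEsubset; split; first exact: subset_closure.
move=> x xS; apply: SP => e e0.
have [|y [Sy]] := xS (ball x e%:C); first by apply: nbhsx_ballx; rewrite ltcR.
by rewrite -ball_normE /= rnE ltcR => yP; exists y.
Qed.

Lemma closureP (S : set V) x :
  closure S x <-> (forall e : R, 0 < e -> exists2 y, S y & rn (x - y) < e).
Proof.
split=> [xS e e0|xP].
  have [|y [Sy]] := xS (ball x e%:C); first by apply: nbhsx_ballx; rewrite ltcR.
  by rewrite -ball_normE /= rnE ltcR => yP; exists y.
have /closedP : closed (closure S) by exact: closed_closure.
by apply=> e /xP[y Sy yP]; exists y => //; exact: subset_closure.
Qed.

Lemma closed_conv (S : set V) u l : closed S -> (forall n, S (u n)) -> conv u l -> S l.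
Proof.
move=> /closedP cS Su cu; apply: cS => e e0.
have [|n nP] := cu (e / 2); first by rewrite divr_gt0.
by exists (u n) => //; rewrite rnB; have := nP n (leqnn n); lra.
Qed.

End Conv.

Lemma rcauchy_conv (V : completeNormedModType K) (u : nat -> V) :
  rcauchy u -> exists l, conv u l.
Proof.
move=> cu; suff /cvg_ex[l /conv_cvg] : cvg (u @ \oo)%classic by exists l.
apply/cauchy_cvgP/cauchyP => e e0.
have e0' : 0 < complex.Re e by move: e0; rewrite ltcE => /andP[].
have [|n nP] := cu (complex.Re e / 2); first by rewrite divr_gt0.
exists (u n), n => // m /= nm; rewrite -ball_normE /= rnE rnB.
have -> : e = (complex.Re e)%:C by rewrite RRe_real // gtr0_real.
by rewrite ltcR; have := nP _ nm; lra.
Qed.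

End RealNorm.

(** * Elementary C*-algebra theory *)

Section CstarBasics.
Variables (R : realType) (A : cstarAlgType R[i]).
Notation K := R[i].
Implicit Types a b c t w x y : A.

Lemma cmul0l a : 0 ** a = 0.
Proof. by have := cmulZl 0 (0 : A) a; rewrite !scale0r. Qed.

Lemma cmul0r a : a ** 0 = 0.
Proof. by have := cmulZr 0 a (0 : A); rewrite !scale0r. Qed.

Lemma cmulNl a b : (- a) ** b = - (a ** b).
Proof. by rewrite -scaleN1r cmulZl scaleN1r. Qed.

Lemma cmulNr a b : a ** (- b) = - (a ** b).
Proof. by rewrite -scaleN1r cmulZr scaleN1r. Qed.

Lemma cmulBl a b c : (a - b) ** c = a ** c - b ** c.
Proof. by rewrite cmulDl cmulNl. Qed.

Lemma cmulBr a b c : a ** (b - c) = a ** b - a ** c.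
Proof. by rewrite cmulDr cmulNr. Qed.

Lemma cmul_suml (I : Type) (r : seq I) (P : pred I) (F : I -> A) b :
  (\sum_(i <- r | P i) F i) ** b = \sum_(i <- r | P i) F i ** b.
Proof. by apply: (big_morph (fun x => x ** b)) => [x y|]; rewrite ?cmulDl ?cmul0l. Qed.

Lemma cmul_sumr (I : Type) (r : seq I) (P : pred I) (F : I -> A) b :
  b ** (\sum_(i <- r | P i) F i) = \sum_(i <- r | P i) b ** F i.
Proof. by apply: (big_morph (cmul b)) => [x y|]; rewrite ?cmulDr ?cmul0r. Qed.

Lemma star0 : star (0 : A) = 0.
Proof. by have := starZ 0 (0 : A); rewrite !scale0r conjC0 scale0r. Qed.

Lemma starN a : star (- a) = - star a.
Proof. by rewrite -scaleN1r starZ rmorphN1 scaleN1r. Qed.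

Lemma starB a b : star (a - b) = star a - star b.
Proof. by rewrite starD starN. Qed.

Lemma star1 : star (cone : A) = cone.
Proof. by rewrite -[LHS]cmul1l -{1}(starK cone) -starM cmul1l starK. Qed.

Lemma star_sum (I : Type) (r : seq I) (P : pred I) (F : I -> A) :
  star (\sum_(i <- r | P i) F i) = \sum_(i <- r | P i) star (F i).
Proof. by apply: (big_morph (@star _ A)) => [x y|]; rewrite ?starD ?star0. Qed.

Lemma conjRC (r : R) : Num.conj (r%:C : K) = r%:C.
Proof. by apply/CrealP; rewrite complex_real. Qed.

Lemma starRZ (r : R) a : star (r%:C *: a) = r%:C *: star a.
Proof. by rewrite starZ conjRC. Qed.

Lemma rnMl a b : rn (a ** b) <= rn a * rn b.
Proof. by rewrite -lecR rmorphM /= -!rnE cnormM. Qed.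

Lemma rn_cstar a : rn (star a ** a) = rn a ^+ 2.
Proof. by apply: complexI; rewrite rmorphXn /= -!rnE cnorm_star. Qed.

Lemma rn_star a : rn (star a) = rn a.
Proof.
have le b : rn b <= rn (star b).
  have [->|b0] := eqVneq (rn b) 0; first exact: rn_ge0.
  have bp : 0 < rn b by rewrite lt_def b0 rn_ge0.
  by rewrite -(ler_pM2r bp) -expr2 -rn_cstar rnMl.
by apply/eqP; rewrite eq_le le andbT; have := le (star a); rewrite starK.
Qed.

Lemma rn_sa_sqr a : star a = a -> rn (a ** a) = rn a ^+ 2.
Proof. by move=> sa; rewrite -{1}sa rn_cstar. Qed.

(** Equality fails in the zero algebra, where the unit has norm 0. *)
Lemma rn_cone : rn (cone : A) <= 1.
Proof.
have := rn_sa_sqr star1; rewrite cmul1l expr2 => h.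
have := rn_ge0 (cone : A); rewrite le_eqVlt => /orP[/eqP<-//|p].
by rewrite -(ler_pM2r p) -h mul1r.
Qed.

Lemma cone0_rn a : (cone : A) = 0 -> a = 0.
Proof. by move=> h; rewrite -(cmul1r a) h cmul0r. Qed.

Lemma rn_cone1 a : a <> 0 -> rn (cone : A) = 1.
Proof.
move=> a0; have := rn_sa_sqr star1; rewrite cmul1l expr2.
have : rn (cone : A) != 0 by apply/eqP => /rn_eq0 /(cone0_rn a).
by move=> n0 h; apply: (mulfI n0); rewrite mulr1 -h.
Qed.

Lemma cstar_eq0 a : star a ** a = 0 -> a = 0.
Proof.
by move=> h; apply/rn_eq0/eqP; rewrite -sqrf_eq0 -rn_cstar h rn0.
Qed.

Lemma conv_star (u : nat -> A) l : conv u l -> conv (fun n => star (u n)) (star l).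
Proof. by apply: (conv_lip (f := @star _ A) (c := 1)) => x y; rewrite -starB rn_star mul1r. Qed.

Lemma conv_mull a (u : nat -> A) l : conv u l -> conv (fun n => a ** u n) (a ** l).
Proof. by apply: (conv_lip (f := cmul a) (c := rn a)) => x y; rewrite -cmulBr rnMl. Qed.

Lemma conv_mulr a (u : nat -> A) l : conv u l -> conv (fun n => u n ** a) (l ** a).
Proof. by apply: (conv_lip (f := fun x => x ** a) (c := rn a)) => x y; rewrite -cmulBl mulrC rnMl. Qed.

Lemma convM (u v : nat -> A) l m : conv u l -> conv v m ->
  conv (fun n => u n ** v n) (l ** m).
Proof.
move=> cu cv e e0; have [b bP] := conv_bounded cu.
have c1 : 0 < `|b| + rn m + 1 by rewrite ltr_pwDr // addr_ge0 // rn_ge0.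
have d0 : 0 < e / (`|b| + rn m + 1) by rewrite divr_gt0.
have [n nP] := cu _ d0; have [n' nP'] := cv _ d0.
exists (maxn n n') => k; rewrite geq_max => /andP[/nP h /nP' h'].
have -> : u k ** v k - l ** m = u k ** (v k - m) + (u k - l) ** m.
  by rewrite cmulBr cmulBl addrA subrK.
apply: le_trans (rnD _ _) _.
apply: le_trans (lerD (rnMl _ _) (rnMl _ _)) _.
set d := e / _ in h h' d0 *.
have -> : e = d * (`|b| + rn m + 1) by rewrite /d divfK ?gt_eqF.
have : rn (u k) * rn (v k - m) <= `|b| * d.
  apply: ler_pM; rewrite ?rn_ge0 //; exact: le_trans (bP k) (ler_norm _).
have : rn (u k - l) * rn m <= d * rn m by rewrite ler_wpM2r ?rn_ge0.
by nra.
Qed.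

(** Threaded through the square root constructions so that roots of elements of [A^0] are known to
    lie in [A^0]. Roots are limits of polynomials, hence closure under [star] is not asked for. *)
Definition sub_closed (S : set A) := [/\ closed S,
  forall (k : K) a b, S a -> S b -> S (k *: a + b) & forall a b, S a -> S b -> S (a ** b)].

Fixpoint cexp a n : A := if n is m.+1 then a ** cexp a m else cone.

Lemma rn_cexp a n : rn (cexp a n) <= rn a ^+ n.
Proof.
elim: n => [|n IH] /=; first exact: rn_cone.
by rewrite exprS; apply: le_trans (rnMl _ _) _; rewrite ler_wpM2l ?rn_ge0.
Qed.

Lemma cexpD a m n : cexp a (m + n) = cexp a m ** cexp a n.
Proof. by elim: m => [|m IH]; [rewrite add0n cmul1l | rewrite addSn /= IH cmulA]. Qed.

Lemma star_cexp a n : star a = a -> star (cexp a n) = cexp a n.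
Proof.
move=> sa; elim: n => [|n IH] /=; first exact: star1.
by rewrite starM IH sa -{2}(cmul1r a) -[a ** cone]/(cexp a 1) -cexpD addn1.
Qed.

Lemma rn_cexp2 a m : star a = a -> rn (cexp a (2 ^ m)) = rn a ^+ (2 ^ m).
Proof.
move=> sa; elim: m => [|m IH]; first by rewrite /= cmul1r.
by rewrite expnS mul2n -addnn cexpD rn_sa_sqr ?star_cexp // IH -exprM muln2 addnn.
Qed.

Lemma neumann t : rn t < 1 -> exists v, v ** (cone - t) = cone /\ (cone - t) ** v = cone.
Proof.
move=> t1; pose s n := \sum_(i < n) cexp t i.
have tc n : cexp t n ** t = t ** cexp t n.
  by rewrite -{2 3}(cmul1r t) -[t ** cone]/(cexp t 1) -!cexpD addnC.
have st n : s n ** (cone - t) = cone - cexp t n.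
  rewrite /s; elim: n => [|n IH]; first by rewrite big_ord0 cmul0l subrr.
  by rewrite big_ord_recr cmulDl IH cmulBr cmul1r tc addrA subrK.
have ts n : (cone - t) ** s n = cone - cexp t n.
  rewrite /s; elim: n => [|n IH]; first by rewrite big_ord0 cmul0r subrr.
  by rewrite big_ord_recr cmulDr IH cmulBl cmul1l addrA subrK.
have tn0 : conv (cexp t) 0.
  move=> e e0; have : ((rn t) ^+ n @[n --> \oo] --> (0 : R))%classic.
    by apply: cvg_expr; rewrite ger0_norm ?rn_ge0.
  move=> /cvgrPdist_le /(_ e e0)[n _ nP]; exists n => m /nP /=.
  rewrite sub0r normrN ger0_norm ?exprn_ge0 ?rn_ge0 // subr0.
  exact: le_trans (rn_cexp _ _).
have [|v cv] := @rcauchy_conv _ A s.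
  move=> e e0; set r := rn t in t1 *; have r0 : 0 <= r by exact: rn_ge0.
  have sc m n : rn (s (n + m)%N - s n) * (1 - r) <= r ^+ n.
    (* Keeping the subtracted term makes the induction on [m] telescope. *)
    suff : rn (s (n + m)%N - s n) * (1 - r) <= r ^+ n - r ^+ (n + m).
      by move/le_trans; apply; rewrite gerBl exprn_ge0.
    elim: m => [|m IH]; first by rewrite addn0 subrr rn0 mul0r subrr.
    rewrite addnS /s big_ord_recr /= -/(s _) addrAC.
    have := rnD (s (n + m)%N - s n) (cexp t (n + m)).
    have := rn_cexp t (n + m); rewrite exprS -/r.
    move: (rn _) (rn _) (rn _) (r ^+ (n + m)) IH => x y z u; nra.
  have : (r ^+ n @[n --> \oo] --> (0 : R))%classic by apply: cvg_expr; rewrite ger0_norm.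
  have d0 : 0 < e * (1 - r) by rewrite mulr_gt0 // subr_gt0.
  move=> /cvgrPdist_le /(_ _ d0)[n _ nP]; exists n => m nm.
  have := nP _ (leqnn n); rewrite /= sub0r normrN ger0_norm ?exprn_ge0 // => le.
  have := sc (m - n)%N n; rewrite subnKC // => /le_trans/(_ le).
  by rewrite ler_pM2r // subr_gt0.
exists v; have c1 : conv (fun n => cone - cexp t n) (cone : A).
  rewrite -[X in conv _ X]subr0; apply: convD; first exact: conv_cst.
  by have := convZ (-1) tn0; rewrite scaleN1r; under eq_fun do rewrite scaleN1r.
split; apply: conv_uniq c1.
  by have := conv_mulr (cone - t) cv; under eq_fun do rewrite st.
by have := conv_mull (cone - t) cv; under eq_fun do rewrite ts.
Qed.

End CstarBasics.

(** * Square roots and positivity *)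

Section SquareRoots.
Variables (R : realType) (A : cstarAlgType R[i]).
Notation K := R[i].
Implicit Types a b c d g h t w x y z : A.

Lemma scRA (r s : R) a : r%:C *: (s%:C *: a) = (r * s)%:C *: a.
Proof. by rewrite scalerA rmorphM. Qed.

Lemma scRM (r s : R) a b : (r%:C *: a) ** (s%:C *: b) = (r * s)%:C *: (a ** b).
Proof. by rewrite cmulZl cmulZr scRA. Qed.

Lemma half_double a : 2^-1%:C *: (a + a) = a.
Proof.
rewrite scalerDr -scalerDl -rmorphD /=.
have -> : 2^-1 + 2^-1 = 1 :> R by field.
by rewrite rmorph1 scale1r.
Qed.

(* A fixed point [w] of [w = (t + w^2) / 2] satisfies [(1 - w)^2 = 1 - t]. The
   scalar iteration for [t = 1] bounds the increments, so that the iteration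
   converges also in the boundary case [rn t = 1]. *)
Fixpoint sqrt_iter t n : A :=
  if n is m.+1 then 2^-1%:C *: (t + sqrt_iter t m ** sqrt_iter t m) else 0.

Fixpoint sqrt_bnd n : R := if n is m.+1 then 2^-1 * (1 + sqrt_bnd m ^+ 2) else 0.

Lemma sqrt_bnd_01 n : 0 <= sqrt_bnd n <= 1.
Proof.
by elim: n => [|n /andP[h0 h1]] /=; rewrite ?lexx ?ler01 //; apply/andP; split; nra.
Qed.

Lemma sqrt_bnd_le n : sqrt_bnd n <= sqrt_bnd n.+1.
Proof. by rewrite /=; have /andP[h0 h1] := sqrt_bnd_01 n; nra. Qed.

Lemma sqrt_iter_rn t n : rn t <= 1 -> rn (sqrt_iter t n) <= sqrt_bnd n.
Proof.
move=> t1; elim: n => [|n IH] /=; first by rewrite rn0.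
rewrite rnRZ ?invr_ge0 // ler_pM2l ?invr_gt0 //.
apply: le_trans (rnD _ _) (lerD t1 _); apply: le_trans (rnMl _ _) _.
by rewrite expr2 ler_pM ?rn_ge0.
Qed.

(** The increment of squares splits as [w (w - v) + (w - v) v], without commutation; its norm is
    dominated by the scalar [(q - p)(q + p)]. *)
Lemma sqrt_iter_step t n : rn t <= 1 ->
  rn (sqrt_iter t n.+1 - sqrt_iter t n) <= sqrt_bnd n.+1 - sqrt_bnd n.
Proof.
move=> t1; elim: n => [|n IH].
  by rewrite /= cmul0l addr0 !subr0 rnRZ ?invr_ge0 // expr0n addr0 ler_pM2l ?invr_gt0.
have wq := sqrt_iter_rn n.+1 t1; have vp := sqrt_iter_rn n t1.
have /andP[q0 _] := sqrt_bnd_01 n.+1; have /andP[p0 _] := sqrt_bnd_01 n.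
have pq := sqrt_bnd_le n.
have -> : sqrt_bnd n.+2 - sqrt_bnd n.+1
        = 2^-1 * ((sqrt_bnd n.+1 - sqrt_bnd n) * (sqrt_bnd n.+1 + sqrt_bnd n)).
  by rewrite /=; ring.
have -> : sqrt_iter t n.+2 - sqrt_iter t n.+1 = 2^-1%:C *:
    (sqrt_iter t n.+1 ** (sqrt_iter t n.+1 - sqrt_iter t n)
     + (sqrt_iter t n.+1 - sqrt_iter t n) ** sqrt_iter t n).
  rewrite [sqrt_iter t n.+2]/= {2}/sqrt_iter -/sqrt_iter -scalerBr; congr (_ *: _).
  set w := sqrt_iter t n.+1; set v := sqrt_iter t n.
  by rewrite cmulBl cmulBr addrA subrK opprD addrACA subrr add0r.
move: (sqrt_iter t n.+1) (sqrt_iter t n) IH wq vp => w v IH wq vp.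
rewrite rnRZ ?invr_ge0 // ler_pM2l ?invr_gt0 // mulrDr [in X in _ <= X + _]mulrC.
apply: le_trans (rnD _ _) (lerD _ _); apply: le_trans (rnMl _ _) _.
  by rewrite ler_pM ?rn_ge0.
by rewrite ler_pM ?rn_ge0.
Qed.

Lemma sqrt_bnd_cauchy (e : R) : 0 < e ->
  exists n, forall m, (n <= m)%N -> sqrt_bnd m - sqrt_bnd n <= e.
Proof.
move=> e0; have nd : {homo sqrt_bnd : n m / (n <= m)%N >-> n <= m}.
  by apply/nondecreasing_seqP; exact: sqrt_bnd_le.
have ub : has_ubound (range sqrt_bnd).
  by exists 1 => _ [n _ <-]; case/andP: (sqrt_bnd_01 n).
have := nondecreasing_cvgn nd ub => /cvgrPdist_le /(_ e e0)[n _ nP].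
exists n => m nm; have := nP n (leqnn n); rewrite /= ler_norml => /andP[_].
by have : sqrt_bnd m <= sup (range sqrt_bnd) by [apply: ub_le_sup; last by exists m]; lra.
Qed.

Lemma sqrt_series t : star t = t -> rn t <= 1 -> exists w,
  [/\ star w = w, rn w <= 1, w + w = t + w ** w,
      forall z, z ** t = t ** z -> z ** w = w ** z
    & forall S : set A, sub_closed S -> S t -> S w].
Proof.
move=> st t1; pose w n := sqrt_iter t n.
have [|l cl] := @rcauchy_conv _ A w.
  move=> e e0; have [n nP] := sqrt_bnd_cauchy e0; exists n => m nm.
  apply: le_trans (nP _ nm); rewrite -(subnKC nm); elim: (m - n)%N => [|k IH].
    by rewrite addn0 !subrr rn0.
  rewrite addnS; apply: le_trans (rn_tri (w (n + k)%N) _ _) _.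
  by have := sqrt_iter_step (n + k) t1; rewrite -/(w _) -/(w (n + k)%N); lra.
exists l; split.
- apply: (conv_uniq _ cl); have := conv_star cl.
  suff -> : (fun n => star (w n)) = w by [].
  by apply/funext; elim=> [|n IH] /=; rewrite ?star0 // starRZ starD st starM IH.
- apply: conv_rn_le cl _ => n; apply: le_trans (sqrt_iter_rn _ t1) _.
  by case/andP: (sqrt_bnd_01 n).
- suff h : l = 2^-1%:C *: (t + l ** l) by rewrite {1 2}h -scalerDr half_double.
  apply: (@conv_uniq _ _ (fun n => w n.+1)).
    by move=> e /cl[n nP]; exists n => m nm; apply: nP; exact: leq_trans nm _.
  by apply: convZ; apply: convD; [exact: conv_cst | exact: convM].
- move=> z zt; apply: (@conv_uniq _ _ (fun n => z ** w n)); first exact: conv_mull.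
  suff -> : (fun n => z ** w n) = (fun n => w n ** z) by exact: conv_mulr.
  apply/funext; elim=> [|n IH] /=; first by rewrite cmul0l cmul0r.
  rewrite cmulZl cmulZr cmulDl cmulDr zt; congr (_ *: (_ + _)).
  by rewrite cmulA [z ** _]IH -!cmulA [z ** _]IH.
- move=> S [Sc Sl SM] St; apply: (closed_conv Sc _ cl).
  have S0 : S 0 by rewrite -(addNr t) -scaleN1r; exact: Sl.
  elim=> [|n IH] //=; rewrite -[X in S X]addr0; apply: (Sl _ _ _ _ S0).
  by have := Sl 1 t _ St (SM _ _ IH IH); rewrite scale1r.
Qed.

(** Take [c = 1 - w] with [w] from [sqrt_series]. The bound [rn (cone - c) <= 1] is what later makes
    a root positive, and the last two clauses stand in for membership in the closed algebra
    generated by [t] and the unit. *)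
Lemma sqrt_cone_sub t : star t = t -> rn t <= 1 -> exists c,
  [/\ star c = c, c ** c = cone - t, rn (cone - c) <= 1,
      forall z, z ** t = t ** z -> z ** c = c ** z
    & forall S : set A, sub_closed S -> S cone -> S t -> S c].
Proof.
move=> st t1; have [w [sw w1 wE wc wS]] := sqrt_series st t1.
exists (cone - w); split.
- by rewrite starB star1 sw.
- have -> : t = w + w - w ** w by rewrite wE addrK.
  by rewrite cmulBl !cmulBr !cmul1l cmul1r !opprD !opprK !addrA.
- by rewrite opprB addrC subrK.
- by move=> z /wc zw; rewrite cmulBl cmulBr cmul1l cmul1r zw.
- move=> S Sc S1 St; have Sw := wS S Sc St; case: Sc => _ Sl _.
  by rewrite addrC -scaleN1r; exact: Sl.
Qed.

End SquareRoots.

Section Positivity.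
Variables (R : realType) (A : cstarAlgType R[i]).
Notation K := R[i].
Implicit Types a b c d g h t w x y z : A.

(* [g + i d] is a multiple of a unitary, and [g] is its real part. *)
Lemma sa_pair_bound g d (r : R) : star g = g -> star d = d -> g ** d = d ** g ->
  0 <= r -> g ** g + d ** d = r%:C *: cone -> rn g ^+ 2 <= r.
Proof.
move=> sg sd gd r0 gdr; pose u := g + 'i%R *: d.
have su : star u = g - 'i%R *: d by rewrite starD starZ sg sd conjCi scaleNr.
have uu : star u ** u = r%:C *: cone.
  rewrite su /u -gdr cmulBl !cmulDr !cmulZl !cmulZr gd scalerA -expr2 sqrCi scaleN1r.
  by rewrite opprD opprK addrA addrK.
have : rn u ^+ 2 <= r.
  by rewrite -rn_cstar uu rnRZ // -[leRHS]mulr1 ler_wpM2l // rn_cone.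
apply: le_trans; rewrite lerXn2r ?nnegrE ?rn_ge0 //.
have -> : g = 2^-1%:C *: (u + star u) by rewrite su addrACA subrr addr0 half_double.
rewrite rnRZ ?invr_ge0 //; have := rnD u (star u); rewrite rn_star.
by rewrite mulrC ler_pdivrMr //; lra.
Qed.

(** The spectrum lies in [[0, 2r]], expressed by the norm alone: stability under sums is then the
    triangle inequality, which is not visible on [cstar_pos]. *)
Definition cpos a := star a = a /\ exists2 r : R, 0 <= r & rn (r%:C *: cone - a) <= r.

Lemma cposD a b : cpos a -> cpos b -> cpos (a + b).
Proof.
move=> [sa [r r0 ra]] [sb [s s0 sb']]; split; first by rewrite starD sa sb.
exists (r + s); first exact: addr_ge0.
rewrite rmorphD /= scalerDl opprD addrACA.
by apply: le_trans (rnD _ _) _; exact: lerD.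
Qed.

Lemma cpos0 : cpos 0.
Proof. by split; [exact: star0 | exists 0 => //; rewrite scale0r subrr rn0]. Qed.

Lemma cposZ (s : R) a : 0 <= s -> cpos a -> cpos (s%:C *: a).
Proof.
move=> s0 [sa [r r0 ra]]; split; first by rewrite starRZ sa.
exists (s * r); first exact: mulr_ge0.
by rewrite -scRA -scalerBr rnRZ // ler_wpM2l.
Qed.

Lemma cpos_sum (I : Type) (r : seq I) (F : I -> A) :
  (forall i, cpos (F i)) -> cpos (\sum_(i <- r) F i).
Proof. by move=> Fp; elim/big_ind: _ => // [|x y]; [exact: cpos0 | exact: cposD]. Qed.

(** With [r = rn c], [g = c / r] and [d] a root of [1 - g^2], one has [r^2 - c^2 = r^2 d^2], and
    [sa_pair_bound] with the roles of [g] and [d] exchanged gives [rn d <= 1]. *)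
Lemma cpos_sqr c : star c = c -> cpos (c ** c).
Proof.
move=> sc; have [->|c0] := eqVneq c 0; first by rewrite cmul0l; exact: cpos0.
split; first by rewrite starM sc.
have r0 : 0 < rn c by rewrite lt_def rn_ge0 andbT; apply: contra_neq c0 => /rn_eq0.
set r := rn c in r0 *; pose g := (r^-1)%:C *: c.
have sg : star g = g by rewrite starRZ sc.
have g1 : rn g = 1 by rewrite rnRZ ?invr_ge0 1?ltW // mulVf // gt_eqF.
have [||d [sd dd _ dc _]] := @sqrt_cone_sub _ A (g ** g).
- by rewrite starM sg.
- by rewrite rn_sa_sqr // g1 expr1n.
exists (r ^+ 2); first exact: exprn_ge0 (ltW r0).
have -> : (r ^+ 2)%:C *: cone - c ** c = (r ^+ 2)%:C *: (d ** d).
  rewrite dd scalerBr; congr (_ - _); rewrite /g scRM scRA.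
  rewrite [X in X%:C](_ : _ = 1) ?rmorph1 ?scale1r //.
  by field; rewrite gt_eqF.
rewrite rnRZ ?exprn_ge0 ?(ltW r0) // -[leRHS]mulr1 ler_pM2l ?exprn_gt0 //.
rewrite rn_sa_sqr //; apply: (@sa_pair_bound d g) => //.
- by rewrite -dc // !cmulA.
- by rewrite dd subrK rmorph1 scale1r.
Qed.

(** Rescaling: [a = r (1 - t)] with [t = 1 - a / r] of norm at most 1, so the root is [sqrt r] times
    a root of [1 - t]. For [r = 0] the bound forces [a = 0]. *)
Lemma cpos_sqrt a : cpos a -> exists c, [/\ star c = c, c ** c = a,
  forall z, z ** a = a ** z -> z ** c = c ** z,
  forall S : set A, sub_closed S -> S cone -> S a -> S c & cpos c].
Proof.
move=> [sa [r]]; rewrite le_eqVlt => /orP[/eqP<-|r0] ra.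
  have -> : a = 0.
    by apply/rn_eq0/eqP; rewrite eq_le rn_ge0 andbT -rnN -[- a]add0r -(scale0r cone).
  exists 0; split; rewrite ?star0 ?cmul0l //; last exact: cpos0.
pose t := cone - (r^-1)%:C *: a.
have r1 : r^-1 * r = 1 by rewrite mulVf // gt_eqF.
have tE : t = (r^-1)%:C *: (r%:C *: cone - a).
  by rewrite scalerBr scRA r1 rmorph1 scale1r.
have [||c [sc cc c1 cz cS]] := @sqrt_cone_sub _ A t.
- by rewrite starB star1 starRZ sa.
- by rewrite tE rnRZ ?invr_ge0 ?(ltW r0) // -r1 ler_pM2l ?invr_gt0.
have q0 : 0 <= Num.sqrt r by exact: sqrtr_ge0.
exists ((Num.sqrt r)%:C *: c); split.
- by rewrite starRZ sc.
- rewrite scRM -expr2 sqr_sqrtr 1?ltW // cc /t opprB addrC subrK scRA.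
  by rewrite mulrC r1 rmorph1 scale1r.
- move=> z za; rewrite cmulZl cmulZr cz // /t cmulBl cmulBr cmul1l cmul1r cmulZl cmulZr.
  by rewrite za.
- move=> S Sc S1 Sa; have Sl : forall k a b, S a -> S b -> S (k *: a + b) by case: Sc.
  have S0 : S 0 by rewrite -(addNr cone) -scaleN1r; exact: Sl.
  rewrite -[X in S X]addr0; apply: (Sl) => //; apply: cS => //.
  by rewrite /t addrC -scaleNr; exact: Sl.
- split; first by rewrite starRZ sc.
  exists (Num.sqrt r) => //; rewrite -scalerBr rnRZ //.
  by rewrite -[leRHS]mulr1 ler_wpM2l.
Qed.

Definition cinv_of a b := a ** b = cone /\ b ** a = cone.

Lemma cinv_uniq a b b' : cinv_of a b -> cinv_of a b' -> b = b'.
Proof. by move=> [ab _] [_ b'a]; rewrite -[RHS]cmul1r -ab cmulA b'a cmul1l. Qed.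

(** Write [l + a = (r + l)(1 - (r - a) / (r + l))]; the subtracted element has norm at most
    [r / (r + l) < 1], so the Neumann series applies. *)
Lemma cpos_inv a (l : R) : cpos a -> 0 < l -> exists b, cinv_of (l%:C *: cone + a) b.
Proof.
move=> [sa [r r0 ra]] l0; have rl : 0 < r + l by rewrite ltr_wpDl.
have [|v [vt tv]] := @neumann _ A (((r + l)^-1)%:C *: (r%:C *: cone - a)).
  by rewrite rnRZ ?invr_ge0 ?(ltW rl) // mulrC ltr_pdivrMr // mul1r; lra.
have e : l%:C *: cone + a =
    (r + l)%:C *: (cone - ((r + l)^-1)%:C *: (r%:C *: cone - a)).
  rewrite scalerBr scRA mulfV ?gt_eqF // rmorph1 scale1r opprB rmorphD /= scalerDl.
  by rewrite addrCA [_ + l%:C *: _]addrC addrK addrC.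
exists (((r + l)^-1)%:C *: v); rewrite e; split; rewrite scRM.
  by rewrite tv mulfV ?gt_eqF // rmorph1 scale1r.
by rewrite vt mulVf ?gt_eqF // rmorph1 scale1r.
Qed.

(* [c] is invertible with inverse [e], so [c ** c - s^2] is again a square for
   [s = 1 / rn e]: the norm of [g] is strictly less than [1]. *)
Lemma sa_pair_strict g c e : star g = g -> star c = c -> g ** c = c ** g ->
  cinv_of c e -> g ** g + c ** c = cone -> cone <> 0 :> A -> rn g < 1.
Proof.
move=> sg sc gc [ce ec] gcc one0.
have se : star e = e.
  apply: (@cinv_uniq c); last by split.
  by split; rewrite -[in LHS]sc -starM ?ec ?ce star1.
have ge : g ** e = e ** g.
  by rewrite -[LHS]cmul1l -ec -!cmulA [c ** (g ** e)]cmulA -gc -cmulA ce cmul1r.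
have e0 : 0 < rn e.
  rewrite lt_def rn_ge0 andbT; apply/eqP => /rn_eq0 e0; apply: one0.
  by rewrite -ce e0 cmul0r.
pose s := (rn e)^-1; have s0 : 0 < s by rewrite invr_gt0.
pose e' := s%:C *: e; have se' : star e' = e' by rewrite starRZ se.
have e'1 : rn e' = 1 by rewrite rnRZ ?ltW // mulVf // gt_eqF.
have [||f [sf ff _ fc _]] := @sqrt_cone_sub _ A (e' ** e').
- by rewrite starM se'.
- by rewrite rn_sa_sqr // e'1 expr1n.
have gf : g ** f = f ** g.
  apply: fc; rewrite /e' scRM cmulZl cmulZr; congr (_ *: _).
  by rewrite cmulA ge -!cmulA ge.
have cf : c ** f = f ** c.
  apply: fc; rewrite /e' scRM cmulZl cmulZr; congr (_ *: _).
  by rewrite cmulA ce -cmulA ec cmul1l cmul1r.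
pose k := c ** f.
have kk : k ** k = c ** c - (s ^+ 2)%:C *: cone.
  rewrite /k {2}cf cmulA -(cmulA c f) ff /e' scRM cmulBr cmulBl cmul1r.
  congr (_ - _); rewrite cmulZr cmulZl; congr (_ *: _).
  by rewrite cmulA ce cmul1l ec.
have s2 : 0 < s ^+ 2 by rewrite exprn_gt0.
have h : g ** g + k ** k = (1 - s ^+ 2)%:C *: cone.
  by rewrite kk addrA gcc rmorphB rmorph1 scalerBl scale1r.
have sk : star k = k by rewrite starM sc sf -cf.
have gk : g ** k = k ** g by rewrite /k cmulA gc -!cmulA gf.
(* [1 = rn (c ** e) <= rn c * rn e] gives [s <= rn c], and [rn c <= 1] is [sa_pair_bound] with [g]
   and [c] exchanged. *)
have s1 : 0 <= 1 - s ^+ 2.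
  have h2 := rn_sa_sqr sc; have : rn (c ** c) <= 1.
    have := sa_pair_bound sc sg (esym gc) ler01; rewrite addrC gcc rmorph1 scale1r h2.
    exact.
  have : 1 <= rn c * rn e.
    by have := rnMl c e; rewrite ce (rn_cone1 one0).
  rewrite h2 subr_ge0 => ce1 c1.
  have : s <= rn c by rewrite /s -[leLHS]mul1r ler_pdivrMr.
  by move=> sc'; apply: le_trans c1; rewrite lerXn2r ?nnegrE ?rn_ge0 ?(ltW s0).
have := sa_pair_bound sg sk gk s1 h => le.
rewrite ltNge; apply/negP => g1.
have : 1 <= rn g ^+ 2 by rewrite exprn_ege1.
by lra.
Qed.

(** This replaces the fact that [|g|^2] is a spectral value of [g^2]. If [g] is nonzero, normalize
    it to [k] of norm 1; invertibility at [l = |g|^2] makes the root [c] of [1 - k^2] invertible,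
    and [sa_pair_strict] gives [rn k < 1]. *)
Lemma sa_sqr_spectrum g : star g = g ->
  (forall l : R, 0 < l -> exists b, cinv_of (l%:C *: cone - g ** g) b) -> g = 0.
Proof.
move=> sg inv; apply/rn_eq0/eqP/negPn/negP => g0.
have r0 : 0 < rn g by rewrite lt_def g0 rn_ge0.
set r := rn g in g0 r0 *; pose k := (r^-1)%:C *: g.
have sk : star k = k by rewrite starRZ sg.
have k1 : rn k = 1 by rewrite rnRZ ?invr_ge0 1?ltW // mulVf.
have one0 : cone <> 0 :> A.
  by move=> /(cone0_rn k) k0; move: k1; rewrite k0 rn0 => /esym/eqP; rewrite oner_eq0.
have [||c [sc cc _ cz _]] := @sqrt_cone_sub _ A (k ** k).
- by rewrite starM sk.
- by rewrite rn_sa_sqr // k1 expr1n.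
have [|b [b1 b2]] := inv (r ^+ 2); first by rewrite exprn_gt0.
have ccE : c ** c = ((r ^+ 2)^-1)%:C *: ((r ^+ 2)%:C *: cone - g ** g).
  rewrite cc /k scRM scalerBr scRA mulVf ?expf_neq0 // rmorph1 scale1r.
  by rewrite -invfM -expr2.
pose b' := (r ^+ 2)%:C *: b.
have cb : c ** c ** b' = cone.
  by rewrite ccE /b' scRM b1 mulVf ?expf_neq0 // rmorph1 scale1r.
have bc : b' ** (c ** c) = cone.
  by rewrite ccE /b' scRM b2 mulfV ?expf_neq0 // rmorph1 scale1r.
have kc : k ** c = c ** k by rewrite cz // cmulA.
have [] := @sa_pair_strict k c (c ** b'); rewrite ?k1 ?ltxx //.
  split; first by rewrite cmulA.
  have h : c ** b' = b' ** c.
    by rewrite -[LHS]cmul1l -bc -!cmulA (cmulA c c b') cb cmul1r.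
  by rewrite h -cmulA.
by rewrite cc addrC subrK.
Qed.

End Positivity.

(** * Positivity of the elements [star x ** x] *)

Section StarSquares.
Variables (R : realType) (A : cstarAlgType R[i]).
Notation K := R[i].
Implicit Types a b c d g h t w x y z : A.

(** Jacobson's identity: from an inverse [b] of [l + x y], the element [(1 - y b x) / l] inverts
    [l + y x]. *)
Lemma cinv_swap x y (l : R) b : l != 0 ->
  cinv_of (l%:C *: cone + x ** y) b ->
  exists b', cinv_of (l%:C *: cone + y ** x) b'.
Proof.
move=> l0 [b1 b2]; exists ((l^-1)%:C *: (cone - y ** b ** x)).
have xyb : x ** y ** b = cone - l%:C *: b.
  by rewrite -b1 cmulDl cmulZl cmul1l [X in X - _]addrC addrK.
have bxy : b ** (x ** y) = cone - l%:C *: b.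
  by rewrite -b2 cmulDr cmulZr cmul1r [X in X - _]addrC addrK.
split.
  rewrite cmulZr cmulBr cmul1r cmulDl cmulZl cmul1l.
  have -> : y ** x ** (y ** b ** x) = y ** (x ** y ** b) ** x by rewrite !cmulA.
  rewrite xyb cmulBr cmulBl cmul1r cmulZr cmulZl [l%:C *: _ + (_ - _)]addrC subrK.
  by rewrite addrK scRA mulVf // rmorph1 scale1r.
rewrite cmulZl cmulBl cmul1l cmulDr cmulZr cmul1r.
have -> : y ** b ** x ** (y ** x) = y ** (b ** (x ** y)) ** x by rewrite !cmulA.
rewrite bxy cmulBr cmulBl cmul1r cmulZr cmulZl [l%:C *: _ + (_ - _)]addrC subrK.
by rewrite addrK scRA mulVf // rmorph1 scale1r.
Qed.

(** With [p] and [q] (up to sign) twice the real and imaginary parts of [y], [y ** star y + star y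
    ** y = (p^2 + q^2) / 2]. Hence [y ** star y] is a sum of squares and [l + y ** star y] is
    invertible for [l > 0]. Swapping the factors, [l - g^2] is invertible for all [l > 0], so
    [g = 0]. *)
Lemma neg_sqr_star_sqr y g : star g = g -> star y ** y = - (g ** g) -> y = 0.
Proof.
move=> sg yy; suff g0 : g = 0 by apply: cstar_eq0; rewrite yy g0 cmul0l oppr0.
apply: sa_sqr_spectrum => // l l0.
pose p := y + star y; pose q := 'i%R *: (y - star y).
have sp : star p = p by rewrite starD starK addrC.
have sq : star q = q by rewrite starZ conjCi starB starK scaleNr -scalerN opprB.
have yyE : y ** star y = 2^-1%:C *: (p ** p + q ** q) + g ** g.
  have -> : g ** g = - (star y ** y) by rewrite yy opprK.
  have -> : p ** p + q ** q = (y ** star y + star y ** y) + (y ** star y + star y ** y).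
    rewrite /p /q cmulZl cmulZr scalerA -expr2 sqrCi scaleN1r.
    rewrite !cmulDl !cmulDr !cmulNl !cmulNr opprK !opprD !opprK.
    rewrite -!addrA; set u := y ** y; set v := y ** star y; set s := star y ** y.
    set r := star y ** star y; rewrite addrC -!addrA; congr (_ + _).
    congr (_ + _).
    have -> : - r + u = - (r - u) by rewrite opprB addrC.
    by rewrite addrA addrC (addrA v) subrK.
  by rewrite half_double addrK.
have [b bP] : exists b, cinv_of (l%:C *: cone + y ** star y) b.
  apply: cpos_inv => //; rewrite yyE; apply: cposD; last exact: cpos_sqr.
  by apply: cposZ; [rewrite invr_ge0 | apply: cposD; exact: cpos_sqr].
by have := cinv_swap (lt0r_neq0 l0) bP; rewrite yy.
Qed.

(** Kaplansky's argument. Here [m] is the absolute value of [h = star x ** x], [n = m - h] is twice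
    its negative part, and [h n = - m n]. For [y = x n] and [k] a root of [m] this gives
    [star y ** y = - (k n)^2], hence [x n = 0]. Then [h n] and [m n] vanish, so [n^2 = 0] and
    [h = m]. *)
Lemma cpos_star_sqr x : cpos (star x ** x).
Proof.
set h := star x ** x; have sh : star h = h by rewrite starM starK.
have [m [sm mm mz _ mpos]] := cpos_sqrt (cpos_sqr sh).
have [k [sk kk kz _ _]] := cpos_sqrt mpos.
have hm : h ** m = m ** h by apply: mz; rewrite cmulA.
have km : k ** m = m ** k by rewrite -kk cmulA.
have hk : h ** k = k ** h by exact: kz.
pose n := m - h; have sn : star n = n by rewrite starB sm sh.
have kn : k ** n = n ** k by rewrite cmulBr cmulBl km hk.
have hn : h ** n = - (m ** n) by rewrite !cmulBr mm hm opprB.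
have mn : m ** n = n ** m by rewrite cmulBr cmulBl hm.
have y0 : x ** n = 0.
  apply: (@neg_sqr_star_sqr _ (k ** n)); first by rewrite starM sn sk kn.
  rewrite starM sn -cmulA (cmulA (star x)) -/h hn cmulNr; congr (- _).
  by rewrite {1}kn -kk -!cmulA.
have hn0 : h ** n = 0 by rewrite /h -cmulA y0 cmul0r.
suff -> : h = m by [].
apply/esym/subr0_eq; rewrite -/n; apply: cstar_eq0; rewrite sn.
have : m ** n = 0 by rewrite -[LHS]opprK -hn hn0 oppr0.
by rewrite {2}/n cmulBl => ->; rewrite hn0 subrr.
Qed.

End StarSquares.

(** * Contractivity of *-homomorphisms *)

Section LinearMaps.
Variables (K : numClosedFieldType) (V W : lmodType K) (g : V -> W).
Hypothesis gl : is_linear g.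

Lemma lin_add x y : g (x + y) = g x + g y.
Proof. by have := gl 1 x y; rewrite !scale1r. Qed.

Lemma lin_zero : g 0 = 0.
Proof. by apply: (addrI (g 0)); rewrite -lin_add !addr0. Qed.

Lemma lin_scale k x : g (k *: x) = k *: g x.
Proof. by have := gl k x 0; rewrite lin_zero !addr0. Qed.

Lemma lin_opp x : g (- x) = - g x.
Proof. by rewrite -scaleN1r lin_scale scaleN1r. Qed.

Lemma lin_sub x y : g (x - y) = g x - g y.
Proof. by rewrite lin_add lin_opp. Qed.

Lemma lin_sum (I : Type) (r : seq I) (P : pred I) (F : I -> V) :
  g (\sum_(i <- r | P i) F i) = \sum_(i <- r | P i) g (F i).
Proof. by apply: (big_morph g); [exact: lin_add | exact: lin_zero]. Qed.

End LinearMaps.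

Section Contractivity.
Variables (R : realType) (B D : cstarAlgType R[i]) (f : B -> D).
Hypothesis hf : star_hom f.

(** By the C*-identity it suffices to treat self-adjoint elements. For [g] of norm 1 and [c] a root
    of [1 - g^2] in [B], the images satisfy [f(g)^2 + f(c)^2 = 1], and [sa_pair_bound] applies in
    [D]. *)
Lemma star_hom_contract b : rn (f b) <= rn b.
Proof.
have [fl f1 fM fs] := hf.
suff sa_le a : star a = a -> rn (f a) <= rn a.
  rewrite -ler_sqr ?nnegrE ?rn_ge0 // -!rn_cstar -fs -fM.
  by apply: sa_le; rewrite starM starK.
move=> sa; have [a0|a0] := eqVneq (rn a) 0.
  by have /rn_eq0 -> := a0; rewrite (lin_zero fl) !rn0.
have r0 : 0 < rn a by rewrite lt_def a0 rn_ge0.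
set r := rn a in a0 r0 *; pose g := (r^-1)%:C *: a.
have sg : star g = g by rewrite starRZ sa.
have g1 : rn g = 1 by rewrite rnRZ ?invr_ge0 ?(ltW r0) // mulVf.
have [||c [sc cc _ cz _]] := @sqrt_cone_sub _ B (g ** g).
- by rewrite starM sg.
- by rewrite rn_sa_sqr // g1 expr1n.
have : rn (f g) ^+ 2 <= 1.
  apply: (@sa_pair_bound _ _ (f g) (f c)); rewrite -?fs ?sg ?sc //.
    by rewrite -!fM cz // cmulA.
  by rewrite -!fM cc -(lin_add fl) addrC subrK f1 rmorph1 scale1r.
rewrite -[1](expr1n _ 2) ler_sqr ?nnegrE ?rn_ge0 // /g (lin_scale fl).
by rewrite rnRZ ?invr_ge0 ?(ltW r0) // mulrC ler_pdivrMr // mul1r.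
Qed.

End Contractivity.

(** * Frames without repetitions, since a basis is a finite set *)

Section MergeDuplicates.
Variables (R : realType) (A : cstarAlgType R[i]) (X : set A).
Hypothesis XZ : forall (k : R[i]) x, X x -> X (k *: x).

(* A repeated term [e, e] is replaced by the single term [sqrt 2 e]. *)
Lemma uniq_frame (L : seq A) : (forall e, e \in L -> X e) ->
  exists L', [/\ uniq L', forall e, e \in L' -> X e &
    \sum_(e <- L') e ** star e = \sum_(e <- L) e ** star e].
Proof.
suff main n (M : seq A) : (size M <= n)%N -> (forall e, e \in M -> X e) ->
    exists L', [/\ uniq L', (size L' <= size M)%N, forall e, e \in L' -> X e &
      \sum_(e <- L') e ** star e = \sum_(e <- M) e ** star e].
  by move=> /(main _ _ (leqnn _))[L' [? _ ? ?]]; exists L'.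
elim: n M => [|n IH] [|a M] //= sM XM; try by exists [::].
have [||M' [uM' sM' XM' eM']] := IH M; [by []| by move=> e eM; apply: XM; rewrite inE eM orbT|].
have Xa : X a by apply: XM; rewrite inE eqxx.
have [aM'|aM'] := boolP (a \in M'); last first.
  exists (a :: M'); split; rewrite /= ?aM' ?ltnS //; last by rewrite !big_cons eM'.
  by move=> e; rewrite inE => /orP[/eqP->|/XM'].
pose b := (Num.sqrt 2)%:C *: a.
have sb : b ** star b = a ** star a + a ** star a.
  by rewrite /b starRZ scRM -expr2 sqr_sqrtr // rmorphD rmorph1 scalerDl scale1r.
(* The multiple [b] may itself occur in [M'], so merging has to be repeated; it terminates because
   the merged list is shorter than [a :: M]. *)
have sr : size (b :: rem a M') = size M'.
  by rewrite /= size_rem // prednK // -has_predT; apply/hasP; exists a.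
have [||L' [uL sL XL eL]] := IH (b :: rem a M').
- by rewrite sr; apply: leq_trans sM' _.
- move=> e; rewrite inE => /orP[/eqP->|/mem_rem/XM' //]; exact: XZ.
exists L'; split=> //; first by rewrite sr in sL; apply: leq_trans sL _; exact: leqW.
by rewrite eL !big_cons -eM' (perm_big _ (perm_to_rem aM')) big_cons sb addrA.
Qed.

End MergeDuplicates.

(** * Spectral subspaces and frames *)

Section Spectral.
Variables (R : realType) (A : cstarAlgType R[i]) (gamma : R[i] -> A -> A).
Hypothesis ga : circle_action gamma.
Notation K := R[i].
Notation Sp := (spectral_subspace gamma).
Implicit Types (a b x y : A) (z w : K) (k l : int).

Lemma circle_neq0 z : circle z -> z != 0.
Proof. by move=> cz; rewrite -normr_eq0 cz oner_neq0. Qed.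

Lemma circle1 : circle (1 : K). Proof. exact: normr1. Qed.

Lemma circleM z w : circle z -> circle w -> circle (z * w).
Proof. by move=> cz cw; rewrite /circle /= normrM cz cw mulr1. Qed.

Lemma circleV z : circle z -> circle z^-1.
Proof. by move=> cz; rewrite /circle /= normfV cz invr1. Qed.

Lemma circleX z n : circle z -> circle (z ^+ n).
Proof. by move=> cz; rewrite /circle /= normrX cz expr1n. Qed.

Lemma conj_circle z : circle z -> Num.conj z = z^-1.
Proof.
move=> cz; apply: (mulfI (circle_neq0 cz)).
by rewrite mulfV ?circle_neq0 // -normCK cz expr1n.
Qed.

Lemma circle_rn z : circle z -> rn z = 1.
Proof. by move=> cz; rewrite /rn cz. Qed.

Lemma circleXz z k : circle z -> circle (z ^ k).
Proof. by case: k => n cz; [exact: circleX | exact/circleV/circleX]. Qed.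

Lemma circle_rnX z k : circle z -> rn (z ^ k) = 1.
Proof. by move=> cz; exact/circle_rn/circleXz. Qed.

Lemma gamma_hom z : circle z -> star_hom (gamma z).
Proof. by case: ga => h _ _ _ /h[]. Qed.

Lemma gamma_lin z : circle z -> is_linear (gamma z).
Proof. by move=> /gamma_hom[]. Qed.

Lemma gammaM z a b : circle z -> gamma z (a ** b) = gamma z a ** gamma z b.
Proof. by move=> /gamma_hom[]. Qed.

Lemma gamma_star z a : circle z -> gamma z (star a) = star (gamma z a).
Proof. by move=> /gamma_hom[]. Qed.

Lemma gamma_cone z : circle z -> gamma z cone = cone.
Proof. by move=> /gamma_hom[]. Qed.

Lemma gamma1 a : gamma 1 a = a.
Proof. by case: ga. Qed.

Lemma gamma_mul z w a : circle z -> circle w -> gamma (z * w) a = gamma z (gamma w a).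
Proof. by case: ga => _ _ h _ cz cw; exact: h. Qed.

Lemma rn_gamma z a : circle z -> rn (gamma z a) = rn a.
Proof.
move=> cz; apply/eqP; rewrite eq_le star_hom_contract /=; last exact: gamma_hom.
rewrite -{1}[a]gamma1 -(mulVf (circle_neq0 cz)) gamma_mul //; last exact: circleV.
by apply: star_hom_contract; exact/gamma_hom/circleV.
Qed.

Lemma gamma_near1 a (e : R) : 0 < e -> exists2 d : R, 0 < d &
  forall z, circle z -> rn (z - 1) < d -> rn (gamma z a - a) <= e.
Proof.
case: ga => _ _ _ /(_ a) /subspace_continuousP /(_ 1 circle1) gc e0.
have e0' : 0 < e%:C :> K by rewrite ltcR.
have /cvgrPdist_le /(_ _ e0') := gc; rewrite near_withinE => /nbhs_ballP[d /= d0 dP].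
have d0' : 0 < complex.Re d by move: d0; rewrite ltcE => /andP[].
exists (complex.Re d) => // z cz z1; rewrite rnB -lecR -rnE -{1}[a]gamma1; apply: dP cz.
rewrite -ball_normE /= rnE rnB.
have -> : d = (complex.Re d)%:C by rewrite RRe_real // gtr0_real.
by rewrite ltcR.
Qed.

Lemma sp_lin l a b : Sp l a -> Sp l b -> forall c : K, Sp l (c *: a + b).
Proof.
move=> Sa Sb c z cz; rewrite (gamma_lin cz) (Sa _ cz) (Sb _ cz).
by rewrite scalerDr !scalerA mulrC.
Qed.

Lemma sp_mul k l a b : Sp k a -> Sp l b -> Sp (k + l) (a ** b).
Proof.
move=> Sa Sb z cz; rewrite gammaM // (Sa _ cz) (Sb _ cz) cmulZl cmulZr scalerA.
by rewrite -expfzDr ?circle_neq0.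
Qed.

Lemma sp_star k a : Sp k a -> Sp (- k) (star a).
Proof.
move=> Sa z cz; rewrite gamma_star // (Sa _ cz) starZ; congr (_ *: _).
by rewrite conj_circle ?invr_expz //; exact: circleXz.
Qed.

Lemma sp_cone : Sp 0 cone.
Proof. by move=> z cz; rewrite gamma_cone // expr0z scale1r. Qed.

Lemma sp_inv a b : Sp 0 a -> cinv_of a b -> Sp 0 b.
Proof.
move=> Sa [ab ba] z cz; rewrite expr0z scale1r.
have Sa' : gamma z a = a by rewrite Sa // expr0z scale1r.
apply: (@cinv_uniq _ _ a); last by split.
by split; rewrite -{1}Sa' -gammaM // ?ab ?ba gamma_cone.
Qed.

Lemma sp_closed k : closed (Sp k).
Proof.
apply/closedP => a aP z cz; apply/eqP; rewrite -subr_eq0; apply/eqP/rn_small => e e0.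
have [|b Sb ab] := aP (e / 2); first by rewrite divr_gt0.
have -> : gamma z a - z ^ k *: a = gamma z (a - b) + z ^ k *: (b - a).
  by rewrite (lin_sub (gamma_lin cz)) (Sb _ cz) scalerBr addrA subrK.
apply: le_trans (rnD _ _) _; rewrite rn_gamma // rnZ circle_rnX // mul1r.
by rewrite (rnB b); lra.
Qed.

Lemma sp_sum k (I : Type) (r : seq I) (F : I -> A) :
  (forall i, Sp k (F i)) -> Sp k (\sum_(i <- r) F i).
Proof.
move=> SF; elim/big_ind: _ => // [|x y Sx Sy].
  by move=> z cz; rewrite (lin_zero (gamma_lin cz)) scaler0.
by rewrite -[x]scale1r; exact: sp_lin.
Qed.

Lemma sp_scale k a (c : K) : Sp k a -> Sp k (c *: a).
Proof. by move=> Sa z cz; rewrite (lin_scale (gamma_lin cz)) Sa // !scalerA mulrC. Qed.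

Lemma sp_sub_closed : sub_closed (Sp 0).
Proof.
split; [exact: sp_closed | by move=> c a b Sa Sb; exact: sp_lin | move=> a b Sa Sb].
by have := sp_mul Sa Sb; rewrite addr0.
Qed.

End Spectral.

Section Frame.
Variables (R : realType) (A : cstarAlgType R[i]) (gamma : R[i] -> A -> A).
Hypotheses (ga : circle_action gamma) (gf : full_action gamma).
Notation K := R[i].
Notation Sp := (spectral_subspace gamma).

Lemma full_approx (k : int) b (e : R) : Sp 0 b -> 0 < e ->
  exists (n : nat) (x y : 'I_n -> A), [/\ forall i, Sp k (x i), forall i, Sp (- k) (y i) &
    rn (b - \sum_i x i ** y i) < e].
Proof.
rewrite -(gf k) => /closureP bP e0; have [_ [n [c [v [vP ->]]]] bv] := bP _ e0.
have /choice[xy xyP] : forall i, exists p : A * A,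
    [/\ Sp k p.1, Sp (- k) p.2 & v i = p.1 ** p.2].
  by move=> i; have [x [y [Sx Sy ->]]] := vP i; exists (x, y).
exists n, (fun i => c i *: (xy i).1), (fun i => (xy i).2); split.
- by move=> i; apply: (sp_scale ga); case: (xyP i).
- by move=> i; case: (xyP i).
under eq_bigr => i _ do rewrite cmulZl.
by under eq_bigr => i _ do (have [_ _ <-] := xyP i).
Qed.

(* With [\sum x y] close to [1], the sum of the [x x^* + y^* y] dominates
   [\sum (x y + y^* x^* )], hence is positive and invertible. *)
Lemma exists_frame : exists2 L : seq A, forall e, e \in L -> Sp 1 e &
  \sum_(e <- L) e ** star e = cone.
Proof.
have [n [x [y [Sx Sy xy1]]]] := full_approx 1 (sp_cone ga) ltr01.
have Sy' i : Sp 1 (star (y i)) by have := sp_star ga (Sy i); rewrite opprK.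
set T := \sum_i _ in xy1; set r := rn _ in xy1.
pose s := \sum_i (x i ** star (x i) + star (y i) ** y i).
have s0 : Sp 0 s.
  apply: (sp_sum ga) => i; have := sp_mul ga (Sx i) (sp_star ga (Sx i)).
  rewrite addrN => h1; have := sp_mul ga (Sy' i) (Sy i); rewrite addrN => h2.
  by have := sp_lin ga h1 h2 1; rewrite scale1r.
have sE : s = T + star T + \sum_i (x i - star (y i)) ** star (x i - star (y i)).
  rewrite /T star_sum -!big_split /=; apply: eq_bigr => i _.
  rewrite starB starK starM cmulBl !cmulBr; set p := x i ** star _; set q := star _ ** y i.
  set u := x i ** y i; set v := star _ ** star _.
  by rewrite opprB addrACA !subrKC.
(* [T + star T] is within [2 r] of 2, so it dominates [2 - 2 r]: subtracting [l] leaves an element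
   that is [cpos] with constant [2 r]. *)
pose l := 2 * (1 - r); have l0 : 0 < l by rewrite mulr_gt0 // subr_gt0.
pose P := (T + star T - l%:C *: cone) + \sum_i (x i - star (y i)) ** star (x i - star (y i)).
have Ppos : cpos P.
  apply: cposD; last first.
    by apply: cpos_sum => i; rewrite -{1}[x i - _]starK; exact: cpos_star_sqr.
  split; first by rewrite starB starD starK starRZ star1 [star T + T]addrC.
  exists (2 * r); first by rewrite mulr_ge0 // rn_ge0.
  have -> : (2 * r)%:C *: cone - (T + star T - l%:C *: cone)
          = (cone - T) + star (cone - T).
    rewrite opprB addrA -scalerDl -rmorphD /l -mulrDr subrKC mulr1.
    rewrite starB star1 rmorphD rmorph1 scalerDl scale1r.
    by rewrite opprD addrACA.
  by apply: le_trans (rnD _ _) _; rewrite rn_star -/r; lra.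
have sP : s = l%:C *: cone + P by rewrite /P addrA subrKC.
have [b bP] := cpos_inv Ppos l0; rewrite -sP in bP.
have spos : cpos s.
  rewrite sP; apply: cposD => //; apply: cposZ; first exact: ltW.
  by rewrite -(cmul1l cone); exact: (cpos_sqr (star1 A)).
have [c [sc cc cz cS _]] := cpos_sqrt spos.
have Sc : Sp 0 c by apply: (cS (Sp 0)) => //; [exact: sp_sub_closed | exact: sp_cone].
have bc : b ** c = c ** b.
  by apply: cz; case: bP => -> ->.
have [sb bs] := bP.
(* This is [s^(-1/2)]: [c] is a root of [s], [b] its inverse, and [c] commutes with [b] because [b]
   commutes with [s]. *)
pose d := c ** b.
have dc : cinv_of c d.
  by split; rewrite /d ?[c ** b]esym ?bc; [rewrite cmulA cc | rewrite -bc -cmulA cc].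
have Sd : Sp 0 d by exact: sp_inv dc.
have sd : star d = d.
  apply: (@cinv_uniq _ _ c) => //; case: dc => cd dc'.
  by split; rewrite -[in LHS]sc -starM ?dc' ?cd star1.
clearbody d.
have dsd : d ** s ** d = cone.
  by case: dc => cd dc'; rewrite -cc cmulA dc' cmul1l.
exists ([seq d ** x i | i <- index_enum 'I_n] ++ [seq d ** star (y i) | i <- index_enum 'I_n]).
  move=> e; rewrite mem_cat => /orP[] /mapP[i _ ->].
    by have := sp_mul ga Sd (Sx i); rewrite add0r.
  by have := sp_mul ga Sd (Sy' i); rewrite add0r.
rewrite big_cat !big_map /= -big_split /= -dsd /s cmul_sumr cmul_suml.
apply: eq_bigr => i _; rewrite !starM starK sd cmulDr cmulDl.
by rewrite !cmulA.
Qed.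

Lemma exists_uniq_frame : exists L : seq A, [/\ uniq L, forall e, e \in L -> Sp 1 e &
  \sum_(e <- L) e ** star e = cone].
Proof.
have [L SL eL] := exists_frame.
have [|L' [uL SL' eL']] := @uniq_frame _ A (Sp 1) _ L SL.
  by move=> c x Sx; exact: sp_scale.
by exists L'; rewrite eL'.
Qed.

End Frame.

(** * The Fejer kernel and spectral projections *)

Section Fejer.
Variable R : realType.
Notation K := R[i].
Implicit Types (z w v : K).

(** Any [2^n]-th root of -1 works: its order divides [2^(n+1)], hence is a power of 2, and it does
    not divide [2^n]. *)
Lemma exists_prim_root n : exists w : K, (2 ^ n.+1)%N.-primitive_root w.
Proof.
have n0 : (0 < 2 ^ n)%N by rewrite expn_gt0.
pose w : K := (2 ^ n)%N.-root (-1).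
have wn : w ^+ (2 ^ n) = -1 by rewrite rootCK.
have [||m pm mn] := @prim_order_exists _ (2 ^ n.+1)%N w; first by rewrite expn_gt0.
  by rewrite expnS mulnC exprM wn sqrrN expr1n.
have /(dvdn_pfactor _ _ (isT : prime 2))[j jn mE] := mn.
exists w; suff <- : j = n.+1 by rewrite -mE.
apply/eqP; rewrite eqn_leq jn ltnNge; apply/negP => jn'.
have : w ^+ (2 ^ n) = 1.
  by apply/eqP; rewrite -(prim_order_dvd pm) mE dvdn_exp2l.
by rewrite wn => /eqP; rewrite eq_sym -subr_eq0 opprK -(natrD _ 1 1) pnatr_eq0.
Qed.

Lemma root_circle N w : (0 < N)%N -> w ^+ N = 1 -> circle w.
Proof.
move=> N0 wN; have : `|w| ^+ N = 1 by rewrite -normrX wN normr1.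
by move/eqP; rewrite pexpr_eq1 // => /eqP.
Qed.

Lemma sum_expr_root N v : v ^+ N = 1 -> v != 1 -> \sum_(j < N) v ^+ j = 0.
Proof.
move=> vN v1; apply: (mulfI (_ : v - 1 != 0)); first by rewrite subr_eq0.
by rewrite -subrX1 vN subrr mulr0.
Qed.

(** Its squared modulus divided by [M] is the Fejer kernel, which is thus visibly nonnegative. *)
Definition dirichlet M z : K := \sum_(i < M) z ^+ i.

Lemma dirichlet_sqr M z : circle z ->
  ((rn (dirichlet M z)) ^+ 2)%:C = \sum_(i < M) \sum_(i' < M) z ^ (i%:Z - i'%:Z).
Proof.
move=> cz; rewrite rmorphXn /= -rnE normCK /dirichlet rmorph_sum mulr_suml.
apply: eq_bigr => i _; rewrite mulr_sumr; apply: eq_bigr => i' _.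
rewrite /= conj_circle; last exact: circleX.
by rewrite expfzDr ?circle_neq0 // -exprnN.
Qed.

Lemma dirichlet_le M z : circle z -> rn (z - 1) * rn (dirichlet M z) <= 2.
Proof.
move=> cz; rewrite -rnM -subrX1; apply: le_trans (rnD _ _) _.
by rewrite rnN rn1 circle_rn ?lexx //; exact: circleX.
Qed.

Lemma expr_exprz_swap w j (k : int) : (w ^+ j) ^ k = (w ^ k) ^+ j.
Proof. by rewrite !exprnP !exprz_exp mulrC. Qed.

(** Orthogonality of characters: in the double sum only [i = i'] survives, because [M <= N] keeps
    distinct [i], [i'] distinct modulo [N]. *)
Lemma dirichlet_sum N w M z : N.-primitive_root w -> (M <= N)%N -> circle z ->
  \sum_(j < N) rn (dirichlet M (z * w ^+ j)) ^+ 2 = N%:R * M%:R.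
Proof.
move=> pw MN cz; have N0 := prim_order_gt0 pw.
have cw := root_circle N0 (prim_expr_order pw).
apply: complexI; rewrite rmorph_sum /=.
under eq_bigr => j _.
  rewrite dirichlet_sqr; last by apply: circleM => //; exact: circleX.
over.
rewrite exchange_big /=.
rewrite (eq_bigr (fun=> N%:R)); last first.
  move=> i _; rewrite exchange_big /= (bigD1 i) //= [X in _ + X]big1 ?addr0.
    rewrite (eq_bigr (fun=> 1)) ?sumr_const ?card_ord //.
    by move=> j _; rewrite subrr expr0z.
  move=> i' i'i; pose v := w ^ (i%:Z - i'%:Z).
  rewrite (eq_bigr (fun j : 'I_N => z ^ (i%:Z - i'%:Z) * v ^+ j)); last first.
    move=> j _; rewrite exprzMl ?unitfE ?circle_neq0 //; last exact: circleX.
    by rewrite expr_exprz_swap.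
  rewrite -mulr_sumr sum_expr_root ?mulr0 //.
    by rewrite -expr_exprz_swap (prim_expr_order pw) exp1rz.
  rewrite /v expfzDr ?circle_neq0 // -exprnP -exprnN.
  apply: contra i'i => /eqP h.
  have /eqP : w ^+ i = w ^+ i'.
    by apply: (mulIf (_ : w ^- i' != 0)); rewrite ?h ?divff ?invr_eq0 ?expf_neq0 ?circle_neq0.
  rewrite (eq_prim_root_expr pw) !modn_small => [/eqP h'||].
  - by apply/eqP/val_inj.
  - exact: leq_trans (ltn_ord i') MN.
  - exact: leq_trans (ltn_ord i) MN.
by rewrite sumr_const card_ord rmorphM /= !rmorph_nat mulr_natr.
Qed.

Lemma dirichlet_far M z (d : R) : circle z -> 0 < d -> d <= rn (z - 1) ->
  rn (dirichlet M z) ^+ 2 <= 4 / d ^+ 2.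
Proof.
move=> cz d0 dz; have := dirichlet_le M cz; have := rn_ge0 (dirichlet M z).
move: (rn _) => D D0 le.
rewrite ler_pdivlMr ?exprn_gt0 // -exprMn.
have -> : 4 = 2 ^+ 2 :> R by rewrite -natrX.
rewrite ler_sqr ?nnegrE ?mulr_ge0 ?ler0n ?(ltW d0) // mulrC.
by apply: le_trans le; rewrite ler_wpM2r.
Qed.

(* Otherwise the Fejer kernel, whose mean over a coset of the roots of unity
   is [1], would be small on the whole coset. *)
Lemma roots_dense (d : R) : 0 < d -> exists M : nat, forall N w z,
  (M <= N)%N -> N.-primitive_root w -> circle z ->
  exists j : 'I_N, rn (z * w ^+ j - 1) < d.
Proof.
(* Any [M > 4 / d^2] will do: if all points were at distance at least [d] from 1, the sum of
   [dirichlet_sum] would be at most [4 N / d^2 < N M]. *)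
move=> d0; exists (Num.truncn (4 / d ^+ 2)).+1 => N w z MN pw cz.
have N0 := prim_order_gt0 pw; have cw := root_circle N0 (prim_expr_order pw).
apply/not_existsP => far; have := dirichlet_sum pw MN cz.
apply/eqP; rewrite lt_eqF //.
have : \sum_(j < N) rn (dirichlet (Num.truncn (4 / d ^+ 2)).+1 (z * w ^+ j)) ^+ 2
    <= \sum_(j < N) (4 / d ^+ 2).
  apply: ler_sum => j _; apply: dirichlet_far => //.
    by apply: circleM => //; exact: circleX.
  by rewrite leNgt; apply/negP => h; exact: far h.
rewrite sumr_const card_ord -[_ *+ N]mulr_natl => /le_lt_trans; apply.
rewrite ltr_pM2l ?ltr0n //.
have := truncn_itv (_ : 0 <= 4 / d ^+ 2); rewrite divr_ge0 ?exprn_ge0 ?(ltW d0) //.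
by move=> /(_ isT)/andP[].
Qed.

End Fejer.

(** * Averages over roots of unity and the spectral projections *)

Section Averages.
Variables (R : realType) (A : cstarAlgType R[i]) (gamma : R[i] -> A -> A).
Hypothesis ga : circle_action gamma.
Notation K := R[i].
Notation Sp := (spectral_subspace gamma).
Implicit Types (a b x y : A) (z w v : K) (k l : int).

(** The action twisted by a character, so that [A^k] becomes its fixed point space. *)
Definition twist k z a : A := z ^ (- k) *: gamma z a.

Lemma twist_lin k z : circle z -> is_linear (twist k z).
Proof.
move=> cz c x y; rewrite /twist (gamma_lin ga cz) scalerDr !scalerA.
by rewrite [c * _]mulrC.
Qed.

Lemma rn_twist k z a : circle z -> rn (twist k z a) = rn a.
Proof. by move=> cz; rewrite rnZ circle_rnX // mul1r rn_gamma. Qed.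

Lemma twistM k z w a : circle z -> circle w -> twist k (z * w) a = twist k z (twist k w a).
Proof.
move=> cz cw; rewrite /twist (gamma_mul ga) // (lin_scale (gamma_lin ga cz)) scalerA.
by rewrite exprzMl // unitfE circle_neq0.
Qed.

Lemma twist_comm k z w a : circle z -> circle w ->
  twist k z (twist k w a) = twist k w (twist k z a).
Proof. by move=> cz cw; rewrite -!twistM // mulrC. Qed.

Lemma twist1 k a : twist k 1 a = a.
Proof. by rewrite /twist exp1rz scale1r (gamma1 ga). Qed.

Lemma twist_fix k a : (forall z, circle z -> twist k z a = a) -> Sp k a.
Proof.
move=> h z cz; rewrite -{2}(h z cz) /twist scalerA -expfzDr ?circle_neq0 //.
by rewrite addrN expr0z scale1r.
Qed.

Lemma twist_sp k l a z : circle z -> Sp l a -> twist k z a = z ^ (l - k) *: a.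
Proof.
by move=> cz Sa; rewrite /twist Sa // scalerA -expfzDr ?circle_neq0 // addrC.
Qed.

Lemma rn_exprz_sub1 k z : circle z -> rn (z ^ k - 1) <= `|k|%:R * rn (z - 1).
Proof.
move=> cz; have pos n : rn (z ^+ n - 1) <= n%:R * rn (z - 1).
  rewrite subrX1 rnM mulrC ler_wpM2r ?rn_ge0 //; apply: le_trans (rn_sum _ _ _) _.
  rewrite (eq_bigr (fun=> 1)) ?sumr_const ?card_ord // => i _.
  exact/circle_rn/circleX.
case: k => n; [exact: pos | rewrite NegzE -exprnN abszN /=].
have -> : z ^- n.+1 - 1 = - (z ^- n.+1) * (z ^+ n.+1 - 1).
  by rewrite mulNr mulrBr mulVf ?expf_neq0 ?circle_neq0 // mulr1 opprB.
by rewrite rnM rnN circle_rn ?mul1r //; apply: circleV; exact: circleX.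
Qed.

Lemma twist_near1 k a (e : R) : 0 < e -> exists2 d : R, 0 < d &
  forall z, circle z -> rn (z - 1) < d -> rn (twist k z a - a) <= e.
Proof.
move=> e0; have [|d d0 dP] := gamma_near1 ga a (e := e / 2); first by rewrite divr_gt0.
pose c : R := `|(- k)%R|%:R * rn a + 1.
have c0 : 0 < c by rewrite ltr_wpDl // mulr_ge0 // rn_ge0.
exists (Num.min d (e / 2 / c)); first by rewrite lt_min d0 !divr_gt0.
move=> z cz; rewrite lt_min => /andP[/(dP _ cz) h1].
rewrite ltr_pdivlMr // => h2.
have -> : twist k z a - a = z ^ (- k) *: (gamma z a - a) + (z ^ (- k) - 1) *: a.
  by rewrite scalerBr scalerBl scale1r addrA subrK.
apply: le_trans (rnD _ _) _; rewrite !rnZ circle_rnX // mul1r.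
have h3 := ler_wpM2r (rn_ge0 a) (rn_exprz_sub1 (- k) cz).
have h4 := rn_ge0 (z - 1); move: h1 h2 h3 h4; rewrite /c.
move: (rn (gamma z a - a)) (rn (z - 1)) (rn (z ^ (- k) - 1)) (rn a) (`|(- k)%R|%:R : R) => p q r s t.
by nra.
Qed.

(** Discrete form of the Fourier coefficient, the Haar integral of [z^(-k) gamma_z(a)]. *)
Definition avg k N w a : A := (N%:R^-1)%:C *: \sum_(j < N) twist k (w ^+ j) a.

Section Root.
Variables (N : nat) (w : K).
Hypothesis pw : N.-primitive_root w.

Let N0 : (0 < N)%N. Proof. exact: prim_order_gt0 pw. Qed.
Let cw : circle w. Proof. exact: root_circle N0 (prim_expr_order pw). Qed.
Let cwX j : circle (w ^+ j). Proof. exact: circleX. Qed.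
Let NR : 0 < N%:R :> R. Proof. by rewrite ltr0n. Qed.

Lemma avg_lin k : is_linear (avg k N w).
Proof.
move=> c x y; rewrite /avg scalerA [c * _]mulrC -scalerA -scalerDr; congr (_ *: _).
by rewrite scaler_sumr -big_split; apply: eq_bigr => j _; rewrite (twist_lin k (cwX j)).
Qed.

Lemma avg_le_of (F : 'I_N -> A) (e : R) : (forall j, rn (F j) <= e) ->
  rn ((N%:R^-1)%:C *: \sum_(j < N) F j) <= e.
Proof.
move=> Fe; rewrite rnRZ ?invr_ge0 ?(ltW NR) // mulrC ler_pdivrMr //.
apply: le_trans (rn_sum _ _ _) _; apply: le_trans (ler_sum _ (fun j _ => Fe j)) _.
by rewrite sumr_const card_ord mulr_natr.
Qed.

Lemma avg_cst a : (N%:R^-1)%:C *: \sum_(j < N) a = a.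
Proof.
rewrite sumr_const card_ord -[a *+ N]scaler_nat scalerA.
have -> : (N%:R^-1)%:C * N%:R = 1 :> K; last by rewrite scale1r.
by rewrite -(rmorph_nat (real_complex R)) -rmorphM mulVf ?gt_eqF // rmorph1.
Qed.

Lemma rn_avg k a : rn (avg k N w a) <= rn a.
Proof. by apply: avg_le_of => j; rewrite rn_twist. Qed.

Lemma avg_twist_comm k v a : circle v -> avg k N w (twist k v a) = twist k v (avg k N w a).
Proof.
move=> cv; rewrite /avg (lin_scale (twist_lin k cv)) (lin_sum (twist_lin k cv)).
by congr (_ *: _); apply: eq_bigr => j _; rewrite twist_comm.
Qed.

Lemma avg_twist_root k j a : avg k N w (twist k (w ^+ j) a) = avg k N w a.
Proof.
elim: j => [|j IH]; first by rewrite expr0 twist1.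
rewrite -IH exprS twistM //; move: (twist k _ a) => b; rewrite /avg; congr (_ *: _).
under eq_bigr => i _ do rewrite -twistM // -exprSr.
case: N pw => [|n] pn; first by rewrite !big_ord0.
by rewrite big_ord_recr big_ord_recl /= (prim_expr_order pn) expr0 addrC.
Qed.

Lemma avg_sp k a : Sp k a -> avg k N w a = a.
Proof.
move=> Sa; rewrite -[RHS]avg_cst /avg; congr (_ *: _); apply: eq_bigr => j _.
by rewrite (twist_sp _ _ Sa) // subrr expr0z scale1r.
Qed.

(** The average multiplies [a] by the mean of the powers of [w ^ (l - k)], a root of unity different
    from 1 since [N] does not divide [l - k]. *)
Lemma avg_sp0 k l a : Sp l a -> l != k -> (`|l - k| < N)%N -> avg k N w a = 0.
Proof.
move=> Sa lk ltN; rewrite /avg (eq_bigr (fun j : 'I_N => (w ^ (l - k)) ^+ j *: a)).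
  rewrite -scaler_suml sum_expr_root ?scale0r ?scaler0 //.
    by rewrite -expr_exprz_swap (prim_expr_order pw) exp1rz.
  have m0 : (0 < `|l - k|)%N by rewrite absz_gt0 subr_eq0.
  have nd : ~~ (N %| `|l - k|)%N by rewrite gtnNdvd.
  move: nd; rewrite (prim_order_dvd pw).
  case: (l - k) => m //; rewrite NegzE abszN /= -exprnN; apply: contra => /eqP h.
  by rewrite -[w ^+ _]invrK h invr1.
by move=> j _; rewrite (twist_sp _ _ Sa) // expr_exprz_swap.
Qed.

End Root.

(** Divisibility makes every power of [w] a power of [w'], and the average over the larger group is
    invariant under twisting by it. *)
Lemma avg_avg k N w N' w' a : N.-primitive_root w -> N'.-primitive_root w' ->
  (N %| N')%N -> avg k N w (avg k N' w' a) = avg k N' w' a.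
Proof.
move=> pw pw' NN'; rewrite -[RHS](avg_cst pw) {1}/avg; congr (_ *: _).
have cw := root_circle (prim_order_gt0 pw) (prim_expr_order pw).
apply: eq_bigr => j _; rewrite -(avg_twist_comm pw'); last exact: circleX.
have [|i ->] := prim_rootP pw' (x := w ^+ j); last exact: avg_twist_root.
by apply/eqP; rewrite -exprM -(prim_order_dvd pw) dvdn_mull.
Qed.


(** Some [w ^+ j] brings [v] close to 1, and the average does not see this factor. The bound [M] is
    uniform in [v]. *)
Lemma avg_near k a (e : R) : 0 < e -> exists M, forall N w v, (M <= N)%N ->
  N.-primitive_root w -> circle v -> rn (avg k N w (twist k v a) - avg k N w a) <= e.
Proof.
move=> e0; have [d d0 dP] := twist_near1 k a e0.
have [M MP] := roots_dense d0; exists M => N w v MN pw cv.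
have [j jd] := MP N w v MN pw cv.
have cw : circle w by apply: root_circle (prim_order_gt0 pw) (prim_expr_order pw).
have cwj : circle (w ^+ j) by exact: circleX.
rewrite -(avg_twist_root pw k j (twist k v a)) -twistM // mulrC.
rewrite -(lin_sub (avg_lin pw k)); apply: le_trans (rn_avg pw _ _) _.
by apply: dP => //; exact: circleM.
Qed.

Section Limit.
Variable w : nat -> K.
Hypothesis pw : forall n, (2 ^ n.+1)%N.-primitive_root (w n).

Lemma avg_conv k a : exists2 b, Sp k b & conv (fun n => avg k (2 ^ n.+1) (w n) a) b.
Proof.
have large M : exists n0, forall n, (n0 <= n)%N -> (M <= 2 ^ n.+1)%N.
  exists M => n Mn; apply: leq_trans Mn _; apply: leq_trans (leqnSn _) _.
  exact/ltnW/ltn_expl.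
have near e : 0 < e -> exists n0, forall n, (n0 <= n)%N -> forall v, circle v ->
    rn (avg k (2 ^ n.+1) (w n) (twist k v a) - avg k (2 ^ n.+1) (w n) a) <= e.
  move=> e0; have [M MP] := avg_near k a e0; have [n0 n0P] := large M.
  by exists n0 => n nn v cv; apply: MP => //; exact: n0P.
have [|b cb] := @rcauchy_conv _ A (fun n => avg k (2 ^ n.+1) (w n) a).
  move=> e /near[n nP]; exists n => m nm.
  (* The finer average equals its own coarse average, hence is a mean of coarse averages of twists
     of [a], each within [e] of the coarse average of [a]. *)
  rewrite -(avg_avg k a (pw n) (pw m)); last by rewrite dvdn_exp2l.
  rewrite {2}/avg (lin_scale (avg_lin (pw n) k)) (lin_sum (avg_lin (pw n) k)).
  rewrite -[X in _ - X](avg_cst (pw m)) -scalerBr -sumrB; apply: (avg_le_of (pw m)) => j.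
  apply: nP => //; apply: circleX.
  by apply: root_circle (prim_order_gt0 (pw m)) (prim_expr_order (pw m)).
exists b => //; apply: twist_fix => v cv.
have ctb : conv (fun n => twist k v (avg k (2 ^ n.+1) (w n) a)) (twist k v b).
  apply: (conv_lip (f := twist k v) (c := 1)) cb => x y.
  by rewrite -(lin_sub (twist_lin k cv)) rn_twist // mul1r.
apply: (conv_uniq ctb) => e e0; have e20 : 0 < e / 2 by rewrite divr_gt0.
have [n nP] := near _ e20; have [n' nP'] := cb _ e20.
exists (maxn n n') => m; rewrite geq_max => /andP[/nP/(_ _ cv) h /nP' h'].
rewrite -(avg_twist_comm (pw m)) //.
by apply: le_trans (rn_tri (avg k (2 ^ m.+1) (w m) a) _ _) _; lra.
Qed.

End Limit.

End Averages.

(** * Fejer means and density of sums of homogeneous elements *)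

Section HomogeneousDensity.
Variables (R : realType) (A : cstarAlgType R[i]) (gamma : R[i] -> A -> A).
Hypothesis ga : circle_action gamma.
Notation K := R[i].
Notation Sp := (spectral_subspace gamma).
Implicit Types (a b x y : A) (z w v : K) (k l : int).

Definition fejer M N w a : A := ((N%:R * M%:R)^-1)%:C *:
  \sum_(j < N) (rn (dirichlet M (w ^+ j)) ^+ 2)%:C *: gamma (w ^+ j) a.

Lemma fejer_avg M N w a : N.-primitive_root w ->
  fejer M N w a = (M%:R^-1)%:C *: \sum_(i < M) \sum_(i' < M) avg gamma (i'%:Z - i%:Z) N w a.
Proof.
move=> pw; have cw := root_circle (prim_order_gt0 pw) (prim_expr_order pw).
under [in RHS]eq_bigr => i _ do rewrite -scaler_sumr exchange_big /=.
rewrite -scaler_sumr exchange_big /= scRA mulrC -invfM /fejer; congr (_ *: _).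
apply: eq_bigr => j _; rewrite dirichlet_sqr; last exact: circleX.
rewrite scaler_suml; apply: eq_bigr => i _.
rewrite scaler_suml; apply: eq_bigr => i' _.
by rewrite /twist opprB.
Qed.

Lemma fejer_near a (e : R) : 0 < e -> exists2 M, (0 < M)%N &
  forall N w, (M <= N)%N -> N.-primitive_root w -> rn (fejer M N w a - a) <= e.
Proof.
move=> e0; have e20 : 0 < e / 2 by rewrite divr_gt0.
have [d d0 dP] := gamma_near1 ga a e20.
(* Away from 1 the squared modulus is at most [4 / d^2] and [gamma z a - a] has norm at most
   [2 rn a]. These terms add up to at most [N C], which is at most half of [N M e]. *)
pose C : R := 8 / d ^+ 2 * rn a.
have C0 : 0 <= C by rewrite mulr_ge0 ?rn_ge0 // divr_ge0 // exprn_ge0 // ltW.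
have [M M0 MC] : exists2 M : nat, (0 < M)%N & C <= M%:R * (e / 2).
  exists (Num.truncn (C / (e / 2))).+1 => //.
  rewrite -ler_pdivrMr //; apply: ltW.
  by have /andP[] := truncn_itv (divr_ge0 C0 (ltW e20)).
exists M => // N w MN pw; have cw := root_circle (prim_order_gt0 pw) (prim_expr_order pw).
have N0 : 0 < N%:R :> R by rewrite ltr0n (prim_order_gt0 pw).
have M0' : 0 < M%:R :> R by rewrite ltr0n.
have NM0 : 0 < N%:R * M%:R :> R by exact: mulr_gt0.
have S := dirichlet_sum pw MN (circle1 R).
have aE : a = ((N%:R * M%:R)^-1)%:C *:
    \sum_(j < N) (rn (dirichlet M (w ^+ j)) ^+ 2)%:C *: a.
  rewrite -scaler_suml -rmorph_sum /= scRA.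
  under eq_bigr => j _ do rewrite -[w ^+ j]mul1r.
  by rewrite S mulVf ?gt_eqF // rmorph1 scale1r.
rewrite [X in _ - X]aE -scalerBr -sumrB rnRZ ?invr_ge0 ?(ltW NM0) //.
rewrite mulrC ler_pdivrMr //; apply: le_trans (rn_sum _ _ _) _.
apply: (@le_trans _ _ (\sum_(j < N) (rn (dirichlet M (1 * w ^+ j)) ^+ 2 * (e / 2) + C))).
  apply: ler_sum => j _; rewrite mul1r -scalerBr rnRZ ?exprn_ge0 ?rn_ge0 //.
  have cwj : circle (w ^+ j) by exact: circleX.
  have [near|far] := ltP (rn (w ^+ j - 1)) d.
    by rewrite -[leLHS]addr0 lerD // ler_wpM2l ?exprn_ge0 ?rn_ge0 // dP.
  rewrite -[leLHS]add0r lerD //; first by rewrite mulr_ge0 ?exprn_ge0 ?rn_ge0 // ltW.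
  have -> : C = 4 / d ^+ 2 * (rn a + rn a) by rewrite /C; ring.
  apply: ler_pM; rewrite ?exprn_ge0 ?rn_ge0 //; first exact: dirichlet_far.
  by apply: le_trans (rnD _ _) _; rewrite rnN rn_gamma.
rewrite big_split /= -mulr_suml S sumr_const card_ord -[C *+ N]mulr_natl -mulrA -mulrDr.
rewrite [leRHS]mulrC -mulrA ler_pM2l // -(lerD2l (- (M%:R * (e / 2)))) addKr.
by apply: le_trans MC _; have := ltW M0'; lra.
Qed.

(** A finite average need not be homogeneous, but its limit is. With [M] fixed, the Fejer means are
    near [a] for all large orders, and they converge to a sum of homogeneous elements as the order
    grows. *)
Lemma homogeneous_dense a (e : R) : 0 < e -> exists M (b : 'I_M -> 'I_M -> A),
  (forall i j : 'I_M, Sp (j%:Z - i%:Z) (b i j)) /\ rn (a - \sum_i \sum_j b i j) <= e.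
Proof.
move=> e0; have e20 : 0 < e / 2 by rewrite divr_gt0.
have [M M0 MP] := fejer_near a e20.
have /choice[w pw] := @exists_prim_root R.
have /choice[b bP] : forall ij : 'I_M * 'I_M, exists b, Sp ((ij.2 : nat)%:Z - (ij.1 : nat)%:Z) b /\
    conv (fun n => avg gamma (ij.2%:Z - ij.1%:Z) (2 ^ n.+1) (w n) a) b.
  by move=> ij; have [b] := avg_conv ga pw (ij.2%:Z - ij.1%:Z) a; exists b.
have : conv (fun n => fejer M (2 ^ n.+1) (w n) a)
    ((M%:R^-1)%:C *: \sum_i \sum_j b (i, j)).
  under eq_fun => n do rewrite fejer_avg //.
  apply: convZ; apply: conv_sum => i _; apply: conv_sum => j _.
  by case: (bP (i, j)).
move=> /(_ _ e20)[n nP].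
exists M, (fun i j => (M%:R^-1)%:C *: b (i, j)); split.
  by move=> i j; apply: (sp_scale ga); case: (bP (i, j)).
under eq_bigr => i _ do rewrite -scaler_sumr.
rewrite -scaler_sumr; pose m := maxn n M.
have h1 := nP m (leq_maxl _ _).
have Mm : (M <= 2 ^ m.+1)%N.
  by apply: leq_trans (leq_maxr n M) _; exact/ltnW/ltnW/ltn_expl.
have h2 := MP _ _ Mm (pw m); rewrite rnB in h2.
by apply: le_trans (rn_tri (fejer M (2 ^ m.+1) (w m) a) _ _) _; lra.
Qed.

End HomogeneousDensity.

(** * Generation of [A] by [A^0] and [A^1] *)

Section Generation.
Variables (R : realType) (A : cstarAlgType R[i]) (gamma : R[i] -> A -> A).
Hypothesis ga : circle_action gamma.
Notation K := R[i].
Notation Sp := (spectral_subspace gamma).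

Variable L : seq A.
Hypotheses (SL : forall e, e \in L -> Sp 1 e) (L1 : \sum_(e <- L) e ** star e = cone).

Lemma frame_expand a : a = \sum_(e <- L) e ** (star e ** a).
Proof.
rewrite -{1}(cmul1l a) -L1 cmul_suml.
by apply: eq_bigr => e _; rewrite cmulA.
Qed.

Lemma sp_pred (n : nat) a e : e \in L -> Sp n.+1%:Z a -> Sp n%:Z (star e ** a).
Proof.
move=> /SL Se Sa; have := sp_mul ga (sp_star ga Se) Sa.
by rewrite -addn1 PoszD addrC addrK.
Qed.

(** Expanding along the frame, [a = \sum e ** (star e ** a)], lowers a positive degree by one;
    negative degrees follow by taking adjoints. *)
Lemma sp_in_generated (S : set A) : cstar_subalgebra S ->
  (forall a, Sp 0 a -> S a) -> (forall a, Sp 1 a -> S a) -> forall k a, Sp k a -> S a.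
Proof.
move=> [Sc S1 Sl SM Ss] S0 SX.
have Ssum (F : A -> A) : (forall e, e \in L -> S (F e)) -> S (\sum_(e <- L) F e).
  move=> SF; rewrite big_seq; elim/big_ind: _ => // [|x y Sx Sy].
    by rewrite -(addNr cone) -scaleN1r; exact: Sl.
  by rewrite -[x]scale1r; exact: Sl.
have pos n : forall a, Sp n%:Z a -> S a.
  elim: n => [|n IH] a Sa; first exact: S0.
  rewrite (frame_expand a); apply: Ssum => e eL.
  by apply: SM; [exact/SX/SL | exact: IH (sp_pred eL Sa)].
case=> n a Sa; first exact: pos Sa.
rewrite -[a]starK; apply: (Ss); apply: (pos n.+1).
by have := sp_star ga Sa; rewrite NegzE opprK.
Qed.

Lemma generated_full (S : set A) : cstar_subalgebra S ->
  (forall a, Sp 0 a -> S a) -> (forall a, Sp 1 a -> S a) -> forall a, S a.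
Proof.
move=> Ssub S0 SX a; have [Sc S1 Sl _ _] := Ssub.
move/closedP: (Sc); apply=> e e0; have [|M [b [bS ab]]] := homogeneous_dense ga a (e := e / 2).
  by rewrite divr_gt0.
exists (\sum_i \sum_j b i j); last by lra.
have S00 : S 0 by apply: S0 => z cz; rewrite (lin_zero (gamma_lin ga cz)) scaler0.
have SD x y : S x -> S y -> S (x + y) by move=> Sx Sy; rewrite -[x]scale1r; exact: Sl.
elim/big_ind: _ => // i _; elim/big_ind: _ => // j _.
exact: (sp_in_generated Ssub S0 SX (bS i j)).
Qed.

End Generation.

(** * Closed subspaces as complete normed modules *)

Record closedSubspace (K : numClosedFieldType) (V : completeNormedModType K) := {
  cs_set : set V ;
  cs_zero : cs_set 0 ;
  cs_lin : forall (k : K) x y, cs_set x -> cs_set y -> cs_set (k *: x + y) ;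
  cs_closed : closed cs_set
}.

Section ClosedSubspace.
Local Open Scope classical_set_scope.
Variables (K : numClosedFieldType) (V : completeNormedModType K) (S : closedSubspace V).

Definition cs_pred : {pred V} := fun x => x \in cs_set S.

Lemma cs_predP x : reflect (cs_set S x) (x \in cs_pred).
Proof. by apply: (iffP idP); rewrite inE. Qed.

Lemma cs_submod : submod_closed cs_pred.
Proof.
split; first exact/cs_predP/cs_zero.
by move=> k x y /cs_predP Sx /cs_predP Sy; apply/cs_predP/cs_lin.
Qed.

HB.instance Definition _ := GRing.isSubmodClosed.Build K V cs_pred cs_submod.

Record csub := CSub { csval : V ; csvalP : csval \in cs_pred }.

Definition cs_in x (Sx : cs_set S x) : csub := CSub (introT (cs_predP x) Sx).

HB.instance Definition _ := [isSub for csval].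
HB.instance Definition _ := [Choice of csub by <:].
HB.instance Definition _ := [SubChoice_isSubZmodule of csub by <:].
HB.instance Definition _ := [SubZmodule_isSubLmodule of csub by <:].

Definition csub_norm (x : csub) : K := `|csval x|.

Lemma csub_normD x y : csub_norm (x + y) <= csub_norm x + csub_norm y.
Proof. exact: ler_normD. Qed.

Lemma csub_normZ (k : K) x : csub_norm (k *: x) = `|k| * csub_norm x.
Proof. exact: normrZ. Qed.

Lemma csub_norm0 x : csub_norm x = 0 -> x = 0.
Proof. by move=> /normr0_eq0 x0; apply: val_inj. Qed.

HB.instance Definition _ := Lmodule_isNormed.Build K csub csub_normD csub_normZ csub_norm0.

Lemma csub_complete (F : set_system csub) : ProperFilter F -> cauchy F -> cvg F.
Proof.
move=> FF /cauchyP cF.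
have cG : cauchy (csval @ F).
  apply/cauchyP => e /cF[x Fx]; exists (csval x); apply: filterS Fx => y.
  rewrite /= -!ball_normE /= => h; exact: h.
have /cvg_ex[l Gl] : cvg (csval @ F) by exact: cauchy_cvg.
have Sl : cs_set S l.
  rewrite (closure_id (cs_set S)).1; last exact: cs_closed.
  move=> B /Gl FB; have [x xB] := filter_ex (FB : F (csval @^-1` B)).
  by exists (csval x); split=> //; apply/cs_predP/csvalP.
apply/cvg_ex; exists (cs_in Sl).
apply/cvgrPdist_le => e e0; move/cvgrPdist_le : Gl => /(_ e e0).
by apply: filterS => x.
Qed.

HB.instance Definition _ := Uniform_isComplete.Build csub csub_complete.

Lemma csvalS (x : csub) : cs_set S (csval x).
Proof. exact/cs_predP/csvalP. Qed.

Lemma csval_inj (x y : csub) : csval x = csval y -> x = y.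
Proof. exact: val_inj. Qed.

End ClosedSubspace.

(** * The bimodule of degree one *)

Section SpectralModules.
Variables (R : realType) (A : cstarAlgType R[i]) (gamma : R[i] -> A -> A).
Hypothesis ga : circle_action gamma.
Notation K := R[i].
Notation Sp := (spectral_subspace gamma).

Lemma sp_zero k : Sp k 0.
Proof. by move=> z cz; rewrite (lin_zero (gamma_lin ga cz)) scaler0. Qed.

Definition sp_space k : closedSubspace A := {|
  cs_set := Sp k ;
  cs_zero := sp_zero k ;
  cs_lin := fun c x y Sx Sy => sp_lin ga Sx Sy c ;
  cs_closed := sp_closed ga (k := k) |}.

Notation E k := (csub (sp_space k)).
Notation vl := (@csval _ _ (sp_space _)).

Lemma spP k (x : E k) : Sp k (vl x).
Proof. exact: (csvalS x). Qed.

Lemma sp_mul0 a b : Sp 0 a -> Sp 0 b -> Sp 0 (a ** b).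
Proof. by move=> Sa Sb; have := sp_mul ga Sa Sb; rewrite addr0. Qed.

Lemma sp_star0 a : Sp 0 a -> Sp 0 (star a).
Proof. by move=> Sa; have := sp_star ga Sa; rewrite oppr0. Qed.

Definition fix_mul (a b : E 0) : E 0 := cs_in (S := sp_space 0) (sp_mul0 (spP a) (spP b)).
Definition fix_one : E 0 := cs_in (S := sp_space 0) (sp_cone ga).
Definition fix_star (a : E 0) : E 0 := cs_in (S := sp_space 0) (sp_star0 (spP a)).

Definition fixed_algebra : cstarAlgType K.
Proof.
refine (@Build_cstarAlgType K (E 0) fix_mul fix_one fix_star
  _ _ _ _ _ _ _ _ _ _ _ _ _) => *; try apply: csval_inj.
- exact: cmulA.
- exact: cmul1l.
- exact: cmul1r.
- exact: cmulDl.
- exact: cmulDr.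
- exact: cmulZl.
- exact: cmulZr.
- exact: starK.
- exact: starD.
- exact: starZ.
- exact: starM.
- exact: cnormM.
- exact: cnorm_star.
Defined.

Notation B := fixed_algebra.

Lemma sp_ract a b : Sp 1 a -> Sp 0 b -> Sp 1 (a ** b).
Proof. by move=> Sa Sb; have := sp_mul ga Sa Sb; rewrite addr0. Qed.

Lemma sp_lact b a : Sp 0 b -> Sp 1 a -> Sp 1 (b ** a).
Proof. by move=> Sb Sa; have := sp_mul ga Sb Sa; rewrite add0r. Qed.

Lemma sp_inner a b : Sp 1 a -> Sp 1 b -> Sp 0 (star a ** b).
Proof. by move=> Sa Sb; have := sp_mul ga (sp_star ga Sa) Sb; rewrite addNr. Qed.

Definition mod_ract (x : E 1) (b : B) : E 1 :=
  cs_in (S := sp_space 1) (sp_ract (spP x) (spP b)).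
Definition mod_lact (b : B) (x : E 1) : E 1 :=
  cs_in (S := sp_space 1) (sp_lact (spP b) (spP x)).
Definition mod_inner (x y : E 1) : B :=
  cs_in (S := sp_space 0) (sp_inner (spP x) (spP y)).

(** [vl x] has degree 1 and is no witness in [B]; the square root of [star x ** x] is one, since it
    stays in the closed subalgebra [A^0]. *)
Lemma mod_inner_pos x : cstar_pos (mod_inner x x).
Proof.
have [c [sc cc _ cS _]] := cpos_sqrt (cpos_star_sqr (vl x)).
have Sc : Sp 0 c.
  apply: (cS (Sp 0)); [exact: sp_sub_closed | exact: sp_cone |].
  by apply: sp_inner; exact: spP.
exists (cs_in (S := sp_space 0) Sc : B); apply: csval_inj.
by rewrite /= sc cc.
Qed.

Definition spectral_module : hilbertModule B.
Proof.
refine (@Build_hilbertModule K B (E 1) mod_ract mod_inner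
  _ _ _ _ _ _ _ _ _ _).
- by move=> b c x y; apply: csval_inj; rewrite /= cmulDl cmulZl.
- by move=> x c a b; apply: csval_inj; rewrite /= cmulDr cmulZr.
- by move=> x b c; apply: csval_inj; exact: cmulA.
- by move=> x; apply: csval_inj; exact: cmul1r.
- by move=> x c a b; apply: csval_inj; rewrite /= cmulDr cmulZr.
- by move=> x y b; apply: csval_inj; exact: cmulA.
- by move=> x y; apply: csval_inj; rewrite /= starM starK.
- exact: mod_inner_pos.
- by move=> x /(congr1 vl) /= /cstar_eq0 x0; apply: csval_inj.
- by move=> x; rewrite -[RHS]/(`|star (vl x) ** vl x|) cnorm_star.
Defined.

Hypothesis gf : full_action gamma.

(** An element is recovered from its action on a frame: [b = \sum (b ** e) ** star e]. *)
Lemma mod_lact_inj : injective mod_lact.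
Proof.
have [L SL L1] := exists_frame ga gf.
move=> b c bc; apply: csval_inj.
rewrite -[LHS]cmul1r -[RHS]cmul1r -L1 !cmul_sumr big_seq [RHS]big_seq.
apply: eq_bigr => e eL; rewrite !cmulA; congr (_ ** _).
by have := congr1 (fun f => vl (f (cs_in (S := sp_space 1) (SL e eL)))) bc.
Qed.

Definition spectral_bimodule : hilbertBimodule B.
Proof.
refine (@Build_hilbertBimodule K B spectral_module mod_lact _ _ _ _ mod_lact_inj).
- by move=> b x y; apply: csval_inj; rewrite /= starM -cmulA.
- by move=> x c a b; apply: csval_inj; rewrite /= cmulDl cmulZl.
- by move=> b c x; apply: csval_inj; rewrite /= cmulA.
- by move=> x; apply: csval_inj; exact: cmul1l.
Defined.

Notation X := spectral_bimodule.
Definition incl0 (b : B) : A := vl b.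
Definition incl1 (x : X) : A := vl x.

Lemma incl0_hom : star_hom incl0.
Proof. by []. Qed.

Lemma incl1_lin : is_linear incl1.
Proof. by []. Qed.

(** Fullness of the action in degree -1: a product [x ** y] with [x] in [A^-1] and [y] in [A^1] is
    the inner product of [star x] and [y]. *)
Lemma spectral_full : full_module X.
Proof.
move=> U [b Ub] oU.
have /nbhs_ballP[e /= e0 eU] : nbhs b U by exact: open_nbhs_nbhs.
have e0' : 0 < complex.Re e by move: e0; rewrite ltcE => /andP[].
have [n [x [y [Sx Sy bxy]]]] := full_approx ga gf (-1) (spP b) e0'.
have Sx' i : Sp 1 (star (x i)) by have := sp_star ga (Sx i); rewrite opprK.
rewrite opprK in Sy.
pose p (i : 'I_n) : B := mod_inner (cs_in (S := sp_space 1) (Sx' i))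
  (cs_in (S := sp_space 1) (Sy i)).
exists (\sum_i p i); split; last first.
  exists n, (fun=> 1), p; split; first by move=> i; do 2!eexists.
  by apply: eq_bigr => i _; rewrite scale1r.
apply: eU; rewrite -ball_normE /= -[X in X < _]/(`|incl0 (b - \sum_i p i)|).
have [il _ _ _] := incl0_hom.
rewrite (lin_sub il) (lin_sum il) rnE.
have -> : e = (complex.Re e)%:C by rewrite RRe_real // gtr0_real.
rewrite ltcR; apply: le_lt_trans bxy; rewrite le_eqVlt; apply/orP; left; apply/eqP.
congr (rn (_ - _)); apply: eq_bigr => i _.
by rewrite /incl0 /p /= starK.
Qed.

Lemma spectral_basis : exists s : {fset X}, is_basis s /\
  \sum_(e <- s) incl1 e ** star (incl1 e) = cone.
Proof.
have [L [uL SL L1]] := exists_uniq_frame ga gf.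
(* The default 0 is never taken on [L], whose entries all have degree 1. *)
pose f (a : A) : X := if pselect (Sp 1 a) is left Sa then cs_in (S := sp_space 1) Sa else 0.
have fE a : a \in L -> incl1 (f a) = a.
  by move=> /SL Sa; rewrite /f; case: pselect.
pose s : {fset X} := seq_fset tt (map f L).
have us : perm_eq s (map f L).
  apply: perm_trans (seq_fset_perm _ _) _; rewrite undup_id //.
  by rewrite map_inj_in_uniq // => a b aL bL fab; rewrite -(fE a) // fab fE.
have L1' : \sum_(e <- s) incl1 e ** star (incl1 e) = cone.
  rewrite (perm_big _ us) big_map -[RHS]L1 big_seq [RHS]big_seq.
  by apply: eq_bigr => e eL; rewrite fE.
exists s; split=> // x; apply: csval_inj.
rewrite -[RHS]/(incl1 _) (lin_sum incl1_lin) -[LHS]cmul1l -L1' cmul_suml.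
by apply: eq_bigr => e _; rewrite -cmulA.
Qed.

Lemma incl_pimsner : pimsner_relations incl0 incl1.
Proof.
split; first exact: incl0_hom.
split; first exact: incl1_lin.
split=> //; have [s [sb s1]] := spectral_basis.
by exists s.
Qed.

Lemma incl_generated : cstar_generated (range incl0 `|` range incl1)%classic.
Proof.
move=> S Ssub GS; have [L SL L1] := exists_frame ga gf.
apply/seteqP; split=> // a _.
apply: (generated_full ga SL L1 Ssub) => b Sb; apply: GS.
  by left; exists (cs_in (S := sp_space 0) Sb).
by right; exists (cs_in (S := sp_space 1) Sb).
Qed.

End SpectralModules.

(** * The universal property *)

(** If [s > t > 0], the powers of [s / t = 1 + h] outgrow any factor linear in the exponent. *)
Lemma geometric_growth (R : realType) (s t : R) (C : nat) : 0 <= s -> 0 <= t ->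
  (forall m, s ^+ (2 ^ m) <= (C * 2 ^ m + 1)%N%:R * t ^+ (2 ^ m)) -> s <= t.
Proof.
move=> s0; rewrite le_eqVlt => /orP[/eqP<-|t0] H.
  have := H 0%N; rewrite expn0 !expr1 mulr0; exact.
rewrite leNgt; apply/negP => ts; pose h := s / t - 1.
have h0 : 0 < h by rewrite subr_gt0 ltr_pdivlMr // mul1r.
have bern n : 1 + n%:R * h <= (1 + h) ^+ n.
  elim: n => [|n IH]; first by rewrite mul0r addr0.
  rewrite exprS -natr1; have : 0 <= n%:R * h by rewrite mulr_ge0 // ltW.
  by move: IH; move: (_ ^+ _) (n%:R) => x y; nra.
have H' m : (1 + h) ^+ (2 ^ m) <= (C * 2 ^ m + 1)%N%:R.
  by rewrite subrKC expr_div_n ler_pdivrMr ?exprn_gt0.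
(* Bernoulli alone is only linear in the exponent. Squaring it at [y = 2 ^ m] gives
   [(1 + y h)^2 <= 2 C y + 1], hence [y h^2 <= 2 C]. *)
have bound m : m%:R * h ^+ 2 <= 2 * C%:R.
  have := H' m.+1; rewrite expnS mulnC exprM => le.
  have mM : m%:R <= (2 ^ m)%N%:R :> R by rewrite ler_nat ltnW // ltn_expl.
  have M0 : 0 < (2 ^ m)%N%:R :> R by rewrite ltr0n expn_gt0.
  apply: (@le_trans _ _ ((2 ^ m)%N%:R * h ^+ 2)); first by rewrite ler_wpM2r ?exprn_ge0 // ltW.
  rewrite -(ler_pM2l M0); move: (bern (2 ^ m)%N) le.
  rewrite natrD !natrM; move: (_ ^+ (2 ^ m)%N) ((2 ^ m)%N%:R) M0 => x y y0 b1 b2.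
  have := mulr_ge0 (ltW y0) (ltW h0); nra.
have := bound (Num.truncn (2 * C%:R / h ^+ 2)).+1; apply/negP; rewrite -ltNge.
rewrite -ltr_pdivrMr ?exprn_gt0 //.
have x0 : 0 <= 2 * C%:R / h ^+ 2 by rewrite divr_ge0 ?exprn_ge0 ?(ltW h0) // mulr_ge0.
by have /andP[] := truncn_itv x0.
Qed.

Section Universal.
Variables (R : realType) (A : cstarAlgType R[i]) (gamma : R[i] -> A -> A).
Hypotheses (ga : circle_action gamma) (gf : full_action gamma).
Notation K := R[i].
Notation Sp := (spectral_subspace gamma).
Notation B := (fixed_algebra ga).
Notation X := (spectral_bimodule ga gf).
Notation iB := (@incl0 _ _ _ ga).
Notation iX := (@incl1 _ _ _ ga gf).
Variables (D : cstarAlgType K) (jB : B -> D) (jX : X -> D).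
Hypothesis jP : pimsner_relations jB jX.

Let jB_hom : star_hom jB. Proof. by case: jP. Qed.
Let jBM b c : jB (b ** c) = jB b ** jB c. Proof. by case: jB_hom. Qed.
Let jBs b : jB (star b) = star (jB b). Proof. by case: jB_hom. Qed.
Let jB1 : jB cone = cone. Proof. by case: jB_hom. Qed.
Let jB_lin : is_linear jB. Proof. by case: jB_hom. Qed.
Let jXr x b : jX (ract x b) = jX x ** jB b. Proof. by case: jP => _ [_ []]. Qed.
Let jXl b x : jX (lact b x) = jB b ** jX x. Proof. by case: jP => _ [_ []]. Qed.
Let jXi x y : star (jX x) ** jX y = jB (inner x y). Proof. by case: jP => _ [_ []]. Qed.

Lemma sp0_incl a : Sp 0 a -> exists b : B, iB b = a.
Proof. by move=> Sa; exists (cs_in (S := sp_space ga 0) Sa). Qed.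

Lemma sp1_incl a : Sp 1 a -> exists x : X, iX x = a.
Proof. by move=> Sa; exists (cs_in (S := sp_space ga 1) Sa). Qed.

Lemma iB_sp b : Sp 0 (iB b). Proof. exact: spP. Qed.
Lemma iX_sp x : Sp 1 (iX x). Proof. exact: spP. Qed.

(** Here the relation [\sum jX e ** star (jX e) = 1] in [D] enters: both sides agree after right
    multiplication by each [jX e], since [x <y, e> = b e] in [X]. *)
Lemma cross_inner x y : exists2 b : B, iB b = iX x ** star (iX y) &
  jX x ** star (jX y) = jB b.
Proof.
have [b bE] : exists b : B, iB b = iX x ** star (iX y).
  apply: sp0_incl; have := sp_mul ga (iX_sp x) (sp_star ga (iX_sp y)).
  by rewrite addrN.
exists b => //; case: jP => _ [_ [_ _ _ [s _ s1]]].
rewrite -[LHS]cmul1r -[RHS]cmul1r -s1 !cmul_sumr; apply: eq_bigr => e _.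
rewrite !cmulA; congr (_ ** _); rewrite -cmulA jXi -jXr -jXl; congr (jX _).
by apply: csval_inj; rewrite -[RHS]/(iB b ** iX e) bE /= cmulA.
Qed.

(* The graph of the homomorphism to be constructed, on homogeneous elements. *)
Inductive hgraph : int -> A -> D -> Prop :=
| hgraph0 k : hgraph k 0 0
| hgraphB b : hgraph 0 (iB b) (jB b)
| hgraphX x k l a d : hgraph k a d -> l = k + 1 -> hgraph l (iX x ** a) (jX x ** d)
| hgraphS x k l a d : hgraph k a d -> l = k - 1 ->
    hgraph l (star (iX x) ** a) (star (jX x) ** d)
| hgraphD k a a' d d' : hgraph k a d -> hgraph k a' d' -> hgraph k (a + a') (d + d').

Lemma hgraph_sp k a d : hgraph k a d -> Sp k a.
Proof.
elim=> {k a d} [k|b|x k l a d _ Sa ->|x k l a d _ Sa ->|k a a' d d' _ Sa _ Sa'].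
- exact: sp_zero.
- exact: iB_sp.
- by rewrite addrC; exact: sp_mul (iX_sp x) Sa.
- by rewrite addrC; apply: sp_mul => //; apply: sp_star => //; exact: iX_sp.
- by rewrite -[a]scale1r; exact: sp_lin.
Qed.

(** In the words of [hgraph] an element of [B] stands only at the right end, so a left factor is
    absorbed into the first letter, using [b ** star x = star (x ** star b)]. *)
Lemma hgraph_lmul b k a d : hgraph k a d -> hgraph k (iB b ** a) (jB b ** d).
Proof.
elim=> {k a d} [k|c|x k l a d g _ ->|x k l a d g _ ->|k a a' d d' _ g _ g'].
- by rewrite !cmul0r; exact: hgraph0.
- by rewrite -jBM; exact: (hgraphB (b ** c)).
- by rewrite !cmulA -jXl; exact: (hgraphX (lact b x) g).
- have -> : iB b ** (star (iX x) ** a) = star (iX (ract x (star b))) ** a.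
    by rewrite /= starM starK cmulA.
  have -> : jB b ** (star (jX x) ** d) = star (jX (ract x (star b))) ** d.
    by rewrite jXr starM jBs starK cmulA.
  exact: hgraphS g _.
- by rewrite !cmulDr; exact: hgraphD.
Qed.

Lemma hgraph_mul k l a a' d d' : hgraph k a d -> hgraph l a' d' ->
  hgraph (k + l) (a ** a') (d ** d').
Proof.
move=> g g'; elim: g => {k a d} [k|c|x k m a d _ g ->|x k m a d _ g ->|k a b d e _ g _ h].
- by rewrite !cmul0l; exact: hgraph0.
- by rewrite add0r; exact: hgraph_lmul.
- by rewrite -!cmulA; apply: (hgraphX x g); rewrite addrAC.
- by rewrite -!cmulA; apply: (hgraphS x g); rewrite addrAC.
- by rewrite !cmulDl; exact: hgraphD.
Qed.

Lemma hgraph_cone : hgraph 0 cone cone.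
Proof. by rewrite -jB1; exact: (hgraphB cone). Qed.

Lemma hgraph_star k a d : hgraph k a d -> hgraph (- k) (star a) (star d).
Proof.
elim=> {k a d} [k|c|x k m a d _ g ->|x k m a d _ g ->|k a b d e _ g _ h].
- by rewrite !star0; exact: hgraph0.
- by rewrite oppr0 -jBs; exact: (hgraphB (star c)).
- rewrite !starM opprD; apply: hgraph_mul => //.
  rewrite -[star (iX x)]cmul1r -[star (jX x)]cmul1r.
  by apply: (hgraphS x hgraph_cone); rewrite sub0r.
- rewrite !starM opprB addrC !starK; apply: hgraph_mul => //.
  rewrite -[iX x]cmul1r -[jX x]cmul1r.
  by apply: (hgraphX x hgraph_cone); rewrite add0r.
- by rewrite !starD; exact: hgraphD.
Qed.

Lemma hgraph_scale (c : K) k a d : hgraph k a d -> hgraph k (c *: a) (c *: d).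
Proof.
move=> /(hgraph_lmul (c *: cone)); rewrite (lin_scale jB_lin) jB1.
by rewrite -[iB _]/(c *: cone) !cmulZl !cmul1l.
Qed.

Lemma hgraph_exists k a : Sp k a -> exists d, hgraph k a d.
Proof.
have [L SL L1] := exists_frame ga gf.
have pos n : forall a, Sp n%:Z a -> exists d, hgraph n%:Z a d.
  elim: n => [|n IH] {}a Sa; first by have [b <-] := sp0_incl Sa; exists (jB b); exact: hgraphB.
  suff [d] : exists d, hgraph n.+1 (\sum_(e <- L) e ** (star e ** a)) d.
    by rewrite -(frame_expand L1); exists d.
  rewrite big_seq; elim/big_ind: _ => [|x y [d g] [d' g']|e eL].
  - by exists 0; exact: hgraph0.
  - by exists (d + d'); exact: hgraphD.
  - have [d g] := IH _ (sp_pred ga SL eL Sa); have [x xE] := sp1_incl (SL e eL).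
    by exists (jX x ** d); rewrite -{1}xE; apply: (hgraphX x g); rewrite -addn1.
case: k => n Sa; first exact: pos.
have [d /hgraph_star] : exists d, hgraph n.+1%:Z (star a) d.
  by apply: pos; have := sp_star ga Sa; rewrite NegzE opprK.
by rewrite starK -NegzE; exists (star d).
Qed.

Definition letter (C : cstarAlgType K) (sg : bool) (x : C) := if sg then star x else x.

(* [reduces sg n] holds on the pairs that any [n] letters bring down into the
   graph of [jB]. *)
Fixpoint reduces sg n a d : Prop :=
  if n is m.+1 then forall x : X, reduces sg m (letter sg (iX x) ** a) (letter sg (jX x) ** d)
  else exists2 b : B, a = iB b & d = jB b.

Lemma reduces_lmul sg n b a d : reduces sg n a d -> reduces sg n (iB b ** a) (jB b ** d).
Proof.
elim: n a d => [|n IH] a d /= => [[c -> ->]|h x]; first by exists (b ** c); rewrite ?jBM.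
case: sg IH h => IH h; rewrite !cmulA /=.
  have := h (@lact _ _ X (star b) x); rewrite jXl jBs -[iX _]/(star (iB b) ** iX x) /=.
  by rewrite !starM !starK.
by have := h (@ract _ _ X x b); rewrite jXr.
Qed.

Lemma reduces_add sg n a a' d d' : reduces sg n a d -> reduces sg n a' d' ->
  reduces sg n (a + a') (d + d').
Proof.
elim: n a a' d d' => [|n IH] a a' d d' /= => [[b -> ->] [c -> ->]|h h' x].
  by exists (b + c); rewrite ?(lin_add jB_lin).
by rewrite !cmulDr; exact: IH.
Qed.

Lemma reduces_zero sg n : reduces sg n 0 0.
Proof.
elim: n => [|n IH] /=; first by exists 0; rewrite ?(lin_zero jB_lin).
by move=> x; rewrite !cmul0r.
Qed.

(** Two opposite letters multiply into [B]: by the inner product for [star y ** x], by [cross_inner]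
    for [y ** star x]. *)
Lemma reduces_cross sg n x a d : reduces sg n a d ->
  reduces sg n.+1 (letter (~~ sg) (iX x) ** a) (letter (~~ sg) (jX x) ** d).
Proof.
move=> h y; rewrite !cmulA; case: sg h => /= h.
  by rewrite jXi; exact: (reduces_lmul (inner y x) h).
by have [b <- ->] := cross_inner y x; exact: reduces_lmul.
Qed.

(** Nonnegative degrees are brought down by adjoint letters, negative ones by plain letters;
    [Negz n] is [-(n + 1)], whence [n.+1]. *)
Definition reduces_int (k : int) a d :=
  match k with Posz n => reduces true n a d | Negz n => reduces false n.+1 a d end.

(** Only degree 0 is used in the end, where it says that the pair lies in the graph of [jB]; the
    induction needs all degrees because subwords of a word of degree 0 may have any degree. *)
Lemma hgraph_reduces k a d : hgraph k a d -> reduces_int k a d.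
Proof.
elim=> {k a d} [k|b|x k l a d _ h ->|x k l a d _ h ->|k a a' d d' _ h _ h'].
- by case: k => n; exact: reduces_zero.
- by exists b.
- case: k h => n h; first by rewrite -PoszD addn1; exact: (reduces_cross x h).
  case: n h => [|n] h; first exact: (h x).
  by rewrite NegzE -addn1 PoszD opprD addrNK; exact: (h x).
- case: k h => [[|n]|n] h.
  + exact: (@reduces_cross false 0 x).
  + by rewrite -addn1 PoszD addrK; exact: (h x).
  + by rewrite NegzE -opprD -PoszD addn1 -NegzE; exact: (@reduces_cross false).
- by case: k h h' => n; exact: reduces_add.
Qed.

(** The pair [(star a ** a, star d ** d)] has degree 0, so it is [(iB b, jB b)], and [jB]
    contracts. *)
Lemma hgraph_le k a d : hgraph k a d -> rn d <= rn a.
Proof.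
move=> g; have := hgraph_mul (hgraph_star g) g; rewrite addNr => /hgraph_reduces[b aE dE].
rewrite -ler_sqr ?nnegrE ?rn_ge0 // -!rn_cstar aE dE.
exact: (star_hom_contract jB_hom b).
Qed.


(* Sums of homogeneous pairs whose degrees lie in [-L, L]. *)
Definition graph L p d := exists (a : nat -> A) (e : nat -> D),
  [/\ forall i, hgraph (i%:Z - L%:Z) (a i) (e i),
      p = \sum_(i < L.*2.+1) a i & d = \sum_(i < L.*2.+1) e i].

Lemma graph0 L : graph L 0 0.
Proof.
exists (fun=> 0), (fun=> 0); split; rewrite ?sumr_const ?mul0rn // => i.
exact: hgraph0.
Qed.

Lemma graphD L p q d e : graph L p d -> graph L q e -> graph L (p + q) (d + e).
Proof.
move=> [a [u [au -> ->]]] [b [v [bv -> ->]]].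
exists (fun i => a i + b i), (fun i => u i + v i); rewrite !big_split; split=> // i.
exact: hgraphD.
Qed.

Lemma graph_sum (I : Type) (r : seq I) L (F : I -> A) (G : I -> D) :
  (forall i, graph L (F i) (G i)) -> graph L (\sum_(i <- r) F i) (\sum_(i <- r) G i).
Proof.
move=> FG; elim: r => [|i r IH]; first by rewrite !big_nil; exact: graph0.
by rewrite !big_cons; exact: graphD.
Qed.

Lemma graph_hom L k a d : hgraph k a d -> (`|k| <= L)%N -> graph L a d.
Proof.
move=> g kL; have [i ik iL] : exists2 i : nat, i%:Z - L%:Z = k & (i < L.*2.+1)%N.
  by exists (absz (k + L%:Z)); lia.
exists (fun j => if j == i then a else 0), (fun j => if j == i then d else 0); split.
- by move=> j; case: eqP => [->|_]; [rewrite ik | exact: hgraph0].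
- by rewrite (bigD1 (Ordinal iL)) //= eqxx big1 ?addr0 // => j /negPf; rewrite -val_eqE /= => ->.
- by rewrite (bigD1 (Ordinal iL)) //= eqxx big1 ?addr0 // => j /negPf; rewrite -val_eqE /= => ->.
Qed.

Lemma graph_mono L M p d : (L <= M)%N -> graph L p d -> graph M p d.
Proof.
move=> LM [a [u [au -> ->]]]; apply: graph_sum => i.
by apply: graph_hom (au i) _; have := ltn_ord i; lia.
Qed.

Lemma graph_mul L M p q d e : graph L p d -> graph M q e ->
  graph (L + M) (p ** q) (d ** e).
Proof.
move=> [a [u [au -> ->]]] [b [v [bv -> ->]]]; rewrite !cmul_suml.
apply: graph_sum => i; rewrite !cmul_sumr; apply: graph_sum => j.
apply: graph_hom (hgraph_mul (au i) (bv j)) _.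
by have := ltn_ord i; have := ltn_ord j; lia.
Qed.

Lemma graph_star L p d : graph L p d -> graph L (star p) (star d).
Proof.
move=> [a [u [au -> ->]]]; rewrite !star_sum; apply: graph_sum => i.
by apply: graph_hom (hgraph_star (au i)) _; have := ltn_ord i; lia.
Qed.

Lemma graph_scale (c : K) L p d : graph L p d -> graph L (c *: p) (c *: d).
Proof.
move=> [a [u [au -> ->]]]; rewrite !scaler_sumr; apply: graph_sum => i.
by apply: graph_hom (hgraph_scale c (au i)) _; have := ltn_ord i; lia.
Qed.

Lemma graph_exp L p d n : graph L p d -> graph (n * L) (cexp p n) (cexp d n).
Proof.
move=> g; elim: n => [|n IH] /=; first exact: graph_hom hgraph_cone _.
by rewrite mulSn; exact: graph_mul.
Qed.

Lemma graph_bound L p d : graph L p d -> rn d <= L.*2.+1%:R * rn p.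
Proof.
move=> [a [u [au pE ->]]].
have ap i : (i < L.*2.+1)%N -> rn (a i) <= rn p.
  (* Degrees in [[-L, L]] differ by at most [2 L < 2^(2 L + 1)], so this one finite average already
     isolates the component [a i], without a limit. *)
  move=> iL; have [w pw] := exists_prim_root R L.*2.
  have sE : avg gamma (i%:Z - L%:Z) (2 ^ L.*2.+1) w p = a i; last first.
    by rewrite -sE; apply: (rn_avg ga pw).
  rewrite pE (lin_sum (avg_lin ga pw _)) (bigD1 (Ordinal iL)) //= (avg_sp pw).
    rewrite big1 ?addr0 // => j ji; apply: (avg_sp0 pw (hgraph_sp (au j))).
      by move: ji; rewrite -val_eqE /=; lia.
    have := ltn_ord j; have := @ltn_expl 2 L.*2.+1 isT; lia.
  exact: hgraph_sp (au i).
apply: le_trans (rn_sum _ _ _) _.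
apply: (@le_trans _ _ (\sum_(i < L.*2.+1) rn p)).
  by apply: ler_sum => i _; apply: le_trans (hgraph_le (au i)) (ap _ (ltn_ord i)).
by rewrite sumr_const card_ord mulr_natl.
Qed.

(* Applied to the powers [(p^* p)^(2^m)], the crude bound [graph_bound] has a
   factor linear in [2^m], which disappears in the [2^m]-th root. *)
Lemma graph_le L p d : graph L p d -> rn d <= rn p.
Proof.
move=> g; have g2 := graph_mul (graph_star g) g.
rewrite -ler_sqr ?nnegrE ?rn_ge0 // -!rn_cstar.
apply: (geometric_growth (C := (L + L).*2)); rewrite ?rn_ge0 // => m.
rewrite -!rn_cexp2; try by rewrite starM starK.
have -> : ((L + L).*2 * 2 ^ m + 1 = (2 ^ m * (L + L)).*2.+1)%N.
  by rewrite addn1 mulnC -muln2 mulnA muln2.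
exact: graph_bound (graph_exp (2 ^ m) g2).
Qed.

Lemma graph_dense a (e : R) : 0 < e -> exists L p d, graph L p d /\ rn (a - p) <= e.
Proof.
move=> /(homogeneous_dense ga a)[M [b [bS ab]]].
have /choice[d dP] : forall ij : 'I_M * 'I_M, exists d,
    hgraph ((ij.2 : nat)%:Z - (ij.1 : nat)%:Z) (b ij.1 ij.2) d.
  by move=> ij; exact: hgraph_exists.
exists M, (\sum_i \sum_j b i j), (\sum_i \sum_j d (i, j)); split=> //.
apply: graph_sum => i; apply: graph_sum => j; apply: graph_hom (dP (i, j)) _ => /=.
by have := ltn_ord i; have := ltn_ord j; lia.
Qed.

(** The closure in [A] times [D] of the union of all [graph L]. *)
Definition cgraph a d := forall e : R, 0 < e -> exists L p q,
  [/\ graph L p q, rn (a - p) <= e & rn (d - q) <= e].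

Lemma cgraph_le a d : cgraph a d -> rn d <= rn a.
Proof.
move=> ad; apply/ler_addgt0Pl => e e0.
have [|L [p [q [g ap dq]]]] := ad (e / 2); first by rewrite divr_gt0.
have := graph_le g; have := rnD (d - q) q; have := rnD (p - a) a.
by rewrite !subrK (rnB p); lra.
Qed.

Lemma cgraph_lin (c : K) a b d e : cgraph a d -> cgraph b e -> cgraph (c *: a + b) (c *: d + e).
Proof.
move=> ad be r r0; pose s := r / (rn c + 1).
have c1 : 0 < rn c + 1 by rewrite ltr_pwDr // rn_ge0.
have s0 : 0 < s by rewrite divr_gt0.
have sr : rn c * s + s = r by rewrite /s; field; rewrite gt_eqF.
have [L [p [q [g ap dq]]]] := ad s s0; have [M [p' [q' [g' bp eq]]]] := be s s0.
exists (maxn L M), (c *: p + p'), (c *: q + q'); split.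
- apply: graphD; first by apply: graph_scale; apply: graph_mono g; exact: leq_maxl.
  by apply: graph_mono g'; exact: leq_maxr.
- rewrite opprD addrACA -scalerBr; apply: le_trans (rnD _ _) _.
  by rewrite rnZ -sr lerD // ler_wpM2l // rn_ge0.
- rewrite opprD addrACA -scalerBr; apply: le_trans (rnD _ _) _.
  by rewrite rnZ -sr lerD // ler_wpM2l // rn_ge0.
Qed.

Lemma cgraph_uniq a d e : cgraph a d -> cgraph a e -> d = e.
Proof.
move=> ad ae; have := cgraph_le (cgraph_lin (-1) ad ae).
rewrite !scaleN1r addNr rn0 => le; apply/esym/subr0_eq/rn_eq0/eqP.
by rewrite eq_le rn_ge0 andbT addrC.
Qed.

Lemma graph_cgraph L p d : graph L p d -> cgraph p d.
Proof. by move=> g e e0; exists L, p, d; split; rewrite // subrr rn0 ltW. Qed.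

Lemma cgraph_star a d : cgraph a d -> cgraph (star a) (star d).
Proof.
move=> ad e /ad[L [p [q [g ap dq]]]]; exists L, (star p), (star q).
by split; rewrite -?starB ?rn_star //; exact: graph_star.
Qed.

Lemma rn_mul_near (C : cstarAlgType K) (x y p q : C) (s r : R) :
  rn (x - p) <= s -> rn (y - q) <= s -> 0 < s -> s <= 1 -> s * (rn x + rn y + 1) <= r ->
  rn (x ** y - p ** q) <= r.
Proof.
move=> xp yq s0 s1 sr; have -> : x ** y - p ** q = x ** (y - q) + (x - p) ** q.
  by rewrite cmulBr cmulBl addrA subrK.
apply: le_trans (rnD _ _) _; apply: le_trans (lerD (rnMl _ _) (rnMl _ _)) _.
have q1 : rn q <= rn y + s by have := rnD (q - y) y; rewrite subrK (rnB q); lra.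
have := ler_wpM2l (rn_ge0 x) yq; have := ler_pM (rn_ge0 _) (rn_ge0 _) xp q1.
have := ler_wpM2l (ltW s0) s1; lra.
Qed.

Lemma cgraph_mul a b d e : cgraph a d -> cgraph b e -> cgraph (a ** b) (d ** e).
Proof.
move=> ad be r r0; pose c := rn a + rn b + rn d + rn e + 1.
have c0 : 0 < c by rewrite ltr_pwDr // !addr_ge0 // rn_ge0.
pose s := Num.min 1 (r / c).
have s0 : 0 < s by rewrite lt_min ltr01 divr_gt0.
have s1 : s <= 1 by rewrite ge_min lexx.
have sr : s * c <= r by rewrite -ler_pdivlMr // ge_min lexx orbT.
have [L [p [q [g ap dq]]]] := ad s s0; have [M [p' [q' [g' bp eq]]]] := be s s0.
exists (L + M)%N, (p ** p'), (q ** q'); split; first exact: graph_mul.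
- apply: (rn_mul_near ap bp s0 s1); apply: le_trans sr; rewrite ler_pM2l //.
  by have := rn_ge0 d; have := rn_ge0 e; rewrite /c; lra.
- apply: (rn_mul_near dq eq s0 s1); apply: le_trans sr; rewrite ler_pM2l //.
  by have := rn_ge0 a; have := rn_ge0 b; rewrite /c; lra.
Qed.

(** Approximants of [a] by sums of homogeneous elements have Cauchy images, by [graph_le] applied to
    their differences; completeness of [D] supplies [d]. *)
Lemma cgraph_exists a : exists d, cgraph a d.
Proof.
pose r n : R := n.+1%:R^-1.
have r0 n : 0 < r n by rewrite invr_gt0 ltr0n.
have /choice[f fP] : forall n, exists f : nat * A * D,
    graph f.1.1 f.1.2 f.2 /\ rn (a - f.1.2) <= r n.
  by move=> n; have [L [p [d gp]]] := graph_dense a (r0 n); exists (L, p, d).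
have small (e : R) : 0 < e -> exists n, forall m, (n <= m)%N -> r m <= e.
  move=> e0; exists (Num.truncn e^-1) => m nm.
  rewrite -[leRHS]invrK lef_pV2 ?posrE ?invr_gt0 ?ltr0n //.
  have ei0 : 0 <= e^-1 by rewrite invr_ge0 ltW.
  have /andP[_ /ltW h] := truncn_itv ei0.
  by apply: le_trans h _; rewrite ler_nat ltnS.
have [|d cd] := @rcauchy_conv _ D (fun n => (f n).2).
  move=> e e0; have [|n nP] := small (e / 2); first by rewrite divr_gt0.
  exists n => m nm; have [gm am] := fP m; have [gn an] := fP n.
  have := nP _ nm; have := nP _ (leqnn n).
  have g := graphD (graph_mono (leq_maxl _ (f n).1.1) gm)
    (graph_scale (-1) (graph_mono (leq_maxr (f m).1.1 _) gn)).
  have := graph_le g; rewrite !scaleN1r.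
  have := rn_tri a (f m).1.2 (f n).1.2; rewrite (rnB _ a); lra.
exists d => e e0; have [n nP] := small e e0; have [m mP] := cd e e0.
have [g ap] := fP (maxn n m).
exists (f (maxn n m)).1.1, (f (maxn n m)).1.2, (f (maxn n m)).2; split=> //.
  by apply: le_trans ap (nP _ (leq_maxl _ _)).
by rewrite rnB; apply: mP; exact: leq_maxr.
Qed.

Lemma universal : exists f : A -> D, [/\ star_hom f,
  forall b, f (iB b) = jB b & forall x, f (iX x) = jX x].
Proof.
have /choice[f fP] := cgraph_exists; exists f.
have fE a d : cgraph a d -> f a = d by exact: cgraph_uniq.
have hE k a d : hgraph k a d -> f a = d.
  by move=> g; apply: fE; apply: (graph_cgraph (L := `|k|)); exact: graph_hom g _.
split.
- split.
  + by move=> c a b; apply: fE; exact: cgraph_lin.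
  + exact: hE hgraph_cone.
  + by move=> a b; apply: fE; exact: cgraph_mul.
  + by move=> a; apply: fE; exact: cgraph_star.
- by move=> b; apply: hE (hgraphB b).
- move=> x; rewrite -[iX x]cmul1r -[jX x]cmul1r.
  by apply: (hE 1); apply: (hgraphX x hgraph_cone).
Qed.

End Universal.

Theorem theorem3p1 (R : realType) (A : cstarAlgType R[i])
    (gamma : R[i] -> A -> A) (gamma_action : circle_action gamma)
    (gamma_full : full_action gamma) :
  exists (B : cstarAlgType R[i]) (X : hilbertBimodule B),
    [/\ full_module X, finite_projective X
      & exists (O : cstarAlgType R[i]) (iB : B -> O) (iX : X -> O)
               (alpha : R[i] -> O -> O),
          [/\ is_pimsner_algebra iB iX, is_gauge_action iB iX alpha
            & exists2 theta : O -> A, star_iso theta &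
                forall z, circle z ->
                  forall a, theta (alpha z a) = gamma z (theta a)]].
Proof.
exists (fixed_algebra gamma_action), (spectral_bimodule gamma_action gamma_full).
split; first exact: spectral_full.
  by have [s [sb _]] := spectral_basis gamma_action gamma_full; exists s.
exists A, (@incl0 _ _ _ gamma_action), (@incl1 _ _ _ gamma_action gamma_full), gamma.
split.
- split; first by split=> x y; exact: csval_inj.
  + exact: incl_pimsner.
  + exact: incl_generated.
  + by move=> D jB jX; exact: universal.
- split=> // z cz.
  + by move=> b; rewrite (iB_sp b cz) expr0z scale1r.
  + by move=> x; rewrite (iX_sp x cz) expr1z.
- by exists id => //; split; [split | exists id].
Qed.
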